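(* Let $\mu$ be a partition of $n+1$ and let $(i,j)\in\mu$ be a cell of its diagram. Let $(a_1,b_1),\ldots,(a_p,b_p)$, with $b_1<\cdots<b_p$, be the corners of $\mu$ lying in the shadow of $(i,j)$, i.e. those with $i\le a_\ell$ and $j\le b_\ell$. Then the set $$\mathcal B_{\mu/ij}:=\bigcup_{\ell=1}^{p}\ \bigcup_{u=i}^{\min(i+\alpha_\ell-1,\,a_\ell)}\mathcal A_{u,b_\ell}$$ is a basis of the vector space $M^0_{\mu/ij}$, where the integers $\alpha_\ell$ and the sets $\mathcal A_{u,b_\ell}$ are as defined in the context.
   Context: **Diagrams.** A lattice diagram is a finite subset $D\subset\mathbb N\times\mathbb N$ (with $0\in\mathbb N$); its elements $(r,c)$ are cells, with $r$ the row index and $c$ the column index (both starting at $0$; rows are counted from bottom to top, columns from left to right). A partition $\mu=(\mu_1\ge\mu_2\ge\cdots\ge\mu_k>0)$ is identified with its diagram $\{(r,c): 0\le r\le k-1,\ 0\le c\le \mu_{r+1}-1\}$. A corner of $\mu$ is a cell whose removal leaves the diagram of a partition. For $(i,j)\in\mu$, $\mu/ij$ (also written $\mu/i,j$) denotes the lattice diagram $\mu\setminus\{(i,j)\}$. **Spaces.** For $D=\{(r_1,c_1),\ldots,(r_n,c_n)\}$ with $n$ cells, listed in increasing lexicographic order, and variables $X=x_1,\ldots,x_n$, $Y=y_1,\ldots,y_n$, put $\Delta_D(X;Y)=\det\|x_s^{r_t}y_s^{c_t}\|_{s,t=1}^n\in\mathbb Q[X,Y]$. $M_D$ is the $\mathbb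 Q$-linear span of all partial derivatives, of all orders (including order $0$) and with respect to all the variables, of $\Delta_D$. It is bigraded by degree in $X$ and degree in $Y$; $M_D^0$ is its $Y$-free component, i.e. the subspace of elements of degree $0$ in $Y$. **Tableaux.** A tableau of shape $D$ ($D$ with $n$ cells) is an injective map $T:D\to\{1,\ldots,n\}$. If $T(r,c)=s$, the height of $s$ is $h_T(s)=r$. For a partition diagram, $T$ is standard if its entries strictly increase along rows (left to right) and along columns (bottom to top). The Garnir polynomial of a tableau $T$ of shape $D$ is $$\Delta_T(X)=\prod_{\gamma}\det\big\|x_s^{h_T(t)}\big\|_{s,t\in\gamma},$$ the product running over the sets $\gamma$ of entries of the (nonempty) columns of $T$, with rows and columns of each determinant indexed by $\gamma$ in increasing order. **The numbers $\alpha_T(s)$.** Let $T$ be a standard tableau and let $(r_s,c_s)$ be the position of entry $s$ in $T$. If there are entries $k<s$ of $T$ with $c_k=c_s+1$, let $k$ be the largest one and set $\alpha_T(s)=r_s-r_k$; otherwise set $\alpha_T(s)=r_s+1$. For a partition $\mu$ of $n+1$ and a corner $(a_\ell,b_\ell)$ of $\mu$, $\alpha_\ell$ denotes the value $\alpha_T(n+1)$ for any standard tableau $T$ of shape $\mu$ having $n+1$ in position $(a_\ell,b_\ell)$ (this does not depend on the choice of such $T$). **The sets $\mathcal A_{u,b_\ell}$.** For a corner $(a_\ell,b_\ell)$ of $\mu$, let $\nu_\ell$ be the partition of $n$ obtained from $\mu$ by removing $(a_\ell,b_\ell)$. For a standard tableau $T$ of shape $\nu_\ell$, an integer $0\le u\le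 a_\ell$ and $v=b_\ell$, let $T\!\uparrow_{uv}$ be the tableau of shape $\mu/uv$ given by $T\!\uparrow_{uv}(r,c)=T(r,c)$ if $c\ne v$ or $r<u$, and $T\!\uparrow_{uv}(r,c)=T(r-1,c)$ if $c=v$ and $r>u$. Then $$\mathcal A_{u,b_\ell}:=\big\{\partial_X^{\mathbf m}\Delta_{T\uparrow_{u,b_\ell}}(X)\ :\ T \text{ standard of shape }\nu_\ell,\ \mathbf m=(m_1,\ldots,m_n)\in\mathbb N^n,\ 0\le m_s<\alpha_T(s)\text{ for all }s\big\},$$ where $\partial_X^{\mathbf m}=\partial_{x_1}^{m_1}\cdots\partial_{x_n}^{m_n}$. *)

(* Defs.v *)
From mathcomp Require Export all_boot all_order all_algebra.
From mathcomp Require Export finmap.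
From mathcomp Require Export mpoly.

Set Implicit Arguments.
Unset Strict Implicit.
Unset Printing Implicit Defensive.

Import GRing.Theory.
Local Open Scope ring_scope.
Local Open Scope fset_scope.

(* Linear algebra in a possibly infinite-dimensional space: subsets and       *)
(* subspaces are predicates.                                                  *)

Definition span (V : lmodType rat) (S : V -> Prop) (v : V) : Prop :=
  exists2 s : seq (rat * V),
    (forall x, x \in s -> S x.2) & v = \sum_(x <- s) x.1 *: x.2.

Definition lin_indep (V : lmodType rat) (S : V -> Prop) : Prop :=
  forall (s : seq V) (a : V -> rat),
    uniq s -> (forall v, v \in s -> S v) ->
    \sum_(v <- s) a v *: v = 0 -> forall v, v \in s -> a v = 0.

Definition is_basis (V : lmodType rat) (S W : V -> Prop) : Prop :=
  lin_indep S /\ (forall v, W v <-> span S v).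

(* A cell is a pair (row, column).                                            *)
Notation cell := (nat * nat)%type.

Definition is_part (mu : seq nat) : bool :=
  sorted geq mu && all (leq 1) mu.

Definition diagram (mu : seq nat) : {fset cell} :=
  [fset p in [seq (r, c) | r <- iota 0 (size mu), c <- iota 0 (nth 0%N mu r)]].

Definition is_corner (mu : seq nat) (p : cell) : Prop :=
  p \in diagram mu /\
  exists2 nu : seq nat, is_part nu & diagram nu = diagram mu `\ p.

Definition lex_cell (p q : cell) : bool :=
  (p.1 < q.1)%N || (p.1 == q.1) && (p.2 <= q.2)%N.

Definition lex_cells (D : {fset cell}) : seq cell := sort lex_cell D.

(* Q[X, Y]; Q[X] is regarded as its subring of Y-free polynomials.            *)
Notation QXY n := {mpoly rat[n + n]}.

Section Polynomials.
Variable n : nat.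

Definition varX (s : 'I_n) : QXY n := 'X_(lshift n s).
Definition varY (s : 'I_n) : QXY n := 'X_(rshift n s).

(* Meant for diagrams D with exactly n cells.                                 *)
Definition Delta (D : {fset cell}) : QXY n :=
  \det (\matrix_(s < n, t < n)
    let p := nth (0%N, 0%N) (lex_cells D) t in varX s ^+ p.1 * varY s ^+ p.2).

Definition space_M (D : {fset cell}) : QXY n -> Prop :=
  span (fun q => exists m : 'X_{1.. n + n}, q = mderivm m (Delta D)).

Definition Yfree (q : QXY n) : Prop :=
  forall m : 'X_{1.. n + n}, m \in msupp q -> forall s : 'I_n, m (rshift n s) = 0%N.

Definition space_M0 (D : {fset cell}) (q : QXY n) : Prop :=
  space_M D q /\ Yfree q.

End Polynomials.

(* The entries 1, ..., n of a tableau are shifted to 0, ..., n - 1, so that   *)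
(* an entry s : 'I_n indexes the variable varX s. Only the values of T on the *)
(* cells of D are relevant.                                                   *)
Definition is_tableau (n : nat) (D : {fset cell}) (T : cell -> nat) : Prop :=
  {in D, forall p, (T p < n)%N} /\ {in D &, injective T}.

Definition is_standard (n : nat) (D : {fset cell}) (T : cell -> nat) : Prop :=
  [/\ is_tableau n D T,
      forall r c c', (r, c) \in D -> (r, c') \in D -> (c < c')%N ->
        (T (r, c) < T (r, c'))%N
    & forall r r' c, (r, c) \in D -> (r', c) \in D -> (r < r')%N ->
        (T (r, c) < T (r', c))%N].

(* The cell of D containing the entry s; (0, 0) if there is none.             *)
Definition position (D : {fset cell}) (T : cell -> nat) (s : nat) : cell :=
  if [pick p : D | T (val p) == s] is Some p then val p else (0%N, 0%N).

Definition height (D : {fset cell}) (T : cell -> nat) (s : nat) : nat :=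
  (position D T s).1.

Definition col_entries (n : nat) (D : {fset cell}) (T : cell -> nat) (c : nat) :
    {set 'I_n} :=
  [set s : 'I_n | [exists p : D, ((val p).2 == c) && (T (val p) == s)]].

(* enum_val lists a set of ordinals in increasing order.                      *)
Definition Garnir (n : nat) (D : {fset cell}) (T : cell -> nat) : QXY n :=
  \prod_(c <- [fset p.2 | p in D])
    let g := col_entries n D T c in
    \det (\matrix_(s < #|g|, t < #|g|)
      varX (enum_val s) ^+ height D T (enum_val t)).

(* When T is standard the truncated subtraction is not truncating: if an      *)
(* entry k < s lies in the column to the right of s, it lies in a lower row.  *)
Definition alpha (D : {fset cell}) (T : cell -> nat) (s : nat) : nat :=
  let p := position D T s in
  let K := [seq T q | q <- D & (q.2 == p.2.+1) && (T q < s)%N] in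
  if nilp K then p.1.+1 else (p.1 - height D T (\max_(k <- K) k))%N.

(* The value alpha_T(n + 1), for T standard of shape mu with its largest      *)
(* entry (here n) in the corner p; it does not depend on T.                   *)
Definition corner_alpha (n : nat) (mu : seq nat) (p : cell) (a : nat) : Prop :=
  exists T : cell -> nat,
    [/\ is_standard n.+1 (diagram mu) T, T p = n & alpha (diagram mu) T n = a].

(* The cells of column v strictly above row u receive the entries from one    *)
(* row below; the value at the missing cell (u, v) is irrelevant.             *)
Definition shift_up (u v : nat) (T : cell -> nat) (p : cell) : nat :=
  if (p.2 != v) || (p.1 < u)%N then T p else T (p.1.-1, p.2).

(* The set A_{u, b}, for the corner (a, b) of mu.                             *)
Definition A_set (n : nat) (mu : seq nat) (a b u : nat) (q : QXY n) : Prop :=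
  let D := diagram mu in
  let nu := D `\ (a, b) in
  exists (T : cell -> nat) (m : 'X_{1.. n + n}),
    [/\ is_standard n nu T,
        forall s : 'I_n, (m (lshift n s) < alpha nu T s)%N,
        forall s : 'I_n, m (rshift n s) = 0%N
      & q = mderivm m (Garnir n (D `\ (u, b)) (shift_up u b T))].

Definition B_set (n : nat) (mu : seq nat) (i j : nat) (q : QXY n) : Prop :=
  exists a b al u : nat,
    [/\ is_corner mu (a, b), (i <= a)%N && (j <= b)%N,
        corner_alpha n mu (a, b) al, (i <= u <= minn (i + al - 1) a)%N
      & A_set mu a b u q].

(* Main.v *)
(** Fix an order of the columns: a tableau whose entry [s] lies in column [c_s]
    has a Garnir polynomial that is, up to sign, the coefficient of
    [y_1^c_1 ... y_n^c_n] in the lattice determinant, and the coefficient of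
    [x^m] in it is the determinant of the 0/1 matrix comparing the cells
    [(m_s, c_s)] with the cells of the diagram ([incid]).  Removing a cell from
    the diagram amounts to adding that cell as one more fixed row.

    Independence.  The operator [sum_s d/dx_s] moves the hole [(u, b)] of a
    Garnir polynomial to [(u + 1, b)], and kills it when the hole is at the top
    of its column.  The number of steps needed is [a - u], and the intervals of
    values of [a - u] attached to the different corners [(a, b)] are disjoint:
    they number the rows of [mu] from row [i] on.  Hence independence reduces to
    the diagrams [nu_l], and these reduce to [mu / (0, 0)] with [n - 1] variables
    by looking at the coefficient of the last variable.

    Spanning.  Let [P] be the set of words of row indices in which row [r] occurs
    [mu_r] times, except for one row [r0 >= i] of length [> j] which occurs once
    less.  Each homogeneous element of the space is the lowest-degree part of a
    combination of exponentials [exp <w, x>] with [w] in [P]; in the divided-power and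
    falling-factorial bases this says that its coefficients of degree at most its
    own degree are [sum_w c_w prod_s w_s ^_ m_s].  So the dimension is at most
    [#|P|], and [#|P|] is the number of elements of the basis. *)

Require Import Defs.
From mathcomp Require Import fingroup perm zify ring.

Set Implicit Arguments.
Unset Strict Implicit.
Unset Printing Implicit Defensive.

Import GRing.Theory Num.Theory.
Local Open Scope ring_scope.

(** * Incidence determinants *)

Lemma det_neq0_perm (R : idomainType) n (A : 'M[R]_n) :
  \det A != 0 -> exists p : 'S_n, forall s, A s (p s) != 0.
Proof.
move=> dA; case: (pickP (fun p : 'S_n => \prod_s A s (p s) != 0)) => [p|H].
  by move/prodf_neq0 => Hp; exists p => s; exact: Hp.
case/negP: dA; rewrite /determinant big1 // => p _.
by move/negbT: (H p); rewrite negbK => /eqP ->; rewrite mulr0.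
Qed.

(** Both sides are the derivative of the determinant at [A] in the direction [B], the sum of all
    [B s t * cofactor A s t]. *)
Lemma sum_det_row_col (R : comNzRingType) n (A B : 'M[R]_n) :
  \sum_s \det (\matrix_(i, j) (if i == s then B i j else A i j)) =
  \sum_t \det (\matrix_(i, j) (if j == t then B i j else A i j)).
Proof.
transitivity (\sum_s \sum_t B s t * cofactor A s t).
  apply: eq_bigr => s _; rewrite (expand_det_row _ s); apply: eq_bigr => t _.
  rewrite mxE eqxx; congr (_ * _); rewrite /cofactor; congr (_ * \det _).
  by apply/matrixP => i j; rewrite !mxE eq_sym (negbTE (neq_lift _ _)).
rewrite exchange_big; apply: eq_bigr => t _; rewrite (expand_det_col _ t).
apply: eq_bigr => s _; rewrite mxE eqxx; congr (_ * _).
rewrite /cofactor; congr (_ * \det _).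
by apply/matrixP => i j; rewrite !mxE eq_sym (negbTE (neq_lift _ _)).
Qed.

Lemma det0_row (R : comNzRingType) n (A : 'M[R]_n) s :
  (forall t, A s t = 0) -> \det A = 0.
Proof.
by move=> H; rewrite (expand_det_row _ s) big1 // => t _; rewrite H mul0r.
Qed.

Lemma det0_col (R : comNzRingType) n (A : 'M[R]_n) t :
  (forall s, A s t = 0) -> \det A = 0.
Proof.
by move=> H; rewrite (expand_det_col _ t) big1 // => s _; rewrite H mul0r.
Qed.

(** When [l] consists of [n] distinct cells, this is the sign of a permutation if [z] enumerates
    [l], and 0 otherwise. *)
Definition incid n (z : nat -> cell) (l : seq cell) : rat :=
  \det (\matrix_(s < n, t < n) (z s == nth (0, 0)%N l t)%:R).

Lemma eq_incid n z z' l :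
  (forall s, (s < n)%N -> z s = z' s) -> incid n z l = incid n z' l.
Proof. by move=> H; congr (\det _); apply/matrixP => s t; rewrite !mxE H. Qed.

(** The sign is that of the permutation of the columns, so it does not depend on [z]: reordering the
    cells changes a whole polynomial by one sign. *)
Lemma incid_perm n l l' : size l = n -> perm_eq l l' ->
  exists b : bool, forall z, incid n z l = (-1) ^+ b * incid n z l'.
Proof.
move=> szl pll'; have szl' : size l' == n by rewrite -(perm_size pll') szl.
have /tuple_permP [p Hp] : perm_eq l (Tuple szl') by [].
exists p => z; rewrite mulrC -odd_permV -det_perm -det_mulmx.
rewrite -col_permE; congr (\det _); apply/matrixP => s t; rewrite !mxE Hp.
by rewrite (nth_map t) ?size_enum_ord // nth_ord_enum (tnth_nth (0, 0)%N).
Qed.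

(** A nonzero Leibniz term makes [z] a rearrangement of [l], so that sums and products over [z] can
    be computed on [l]. *)
Lemma incid_neq0 n z l : incid n z l != 0 -> exists p : 'S_n,
  forall s : 'I_n, z s = nth (0, 0)%N l (p s).
Proof.
case/det_neq0_perm => p Hp; exists p => s; move: (Hp s); rewrite mxE.
by case: (z s =P _) => // _; rewrite eqxx.
Qed.

Lemma incid_notin n z l s : size l = n -> (s < n)%N -> z s \notin l ->
  incid n z l = 0.
Proof.
move=> szl lt_sn zNl; apply: (@det0_row _ _ _ (Ordinal lt_sn)) => t.
by rewrite mxE; case: eqP => // zE; case/negP: zNl; rewrite zE mem_nth ?szl.
Qed.

(** The last row has its only nonzero entry in the last column. Read from right to left, this trades
    a missing cell [x] for a fixed extra row. *)
Lemma incid_rcons n z l x : size l = n -> uniq (rcons l x) -> z n = x ->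
  incid n.+1 z (rcons l x) = incid n z l.
Proof.
move=> szl ul zn; rewrite /incid (expand_det_row _ ord_max).
rewrite (bigD1 ord_max) //= big1 ?addr0 => [|t tNmax]; last first.
  rewrite mxE /= zn; have lt_tn : (t < n)%N.
    by rewrite ltn_neqAle -ltnS ltn_ord andbT; apply: contra tNmax => /eqP e; apply/eqP/val_inj.
  rewrite nth_rcons szl lt_tn; case: eqP => [xE|]; last by rewrite mul0r.
  by move: ul; rewrite rcons_uniq xE mem_nth ?szl.
rewrite mxE /= zn nth_rcons szl ltnn !eqxx mulr1n mul1r /cofactor /=.
rewrite -signr_odd oddD addbb mul1r; congr (\det _).
apply/matrixP => s t; rewrite !mxE !lift_max nth_rcons szl.
by rewrite ltn_ord.
Qed.

Definition shiftc h k (p : cell) : cell := (p.1 + h, p.2 + k)%N.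

(* Moving the cell of one row, summed over the rows, is the same as moving back
   one column; in a set of cells closed under the move, the new column is zero
   or repeats another one. *)
Lemma incid_move n z l h k : (0 < h + k)%N -> size l = n -> uniq l ->
  (forall p, shiftc h k p \in l -> p \in l) ->
  \sum_(s < n) incid n (fun s' => if s' == s then shiftc h k (z s') else z s') l
    = 0.
Proof.
move=> hk szl ul dl.
pose A := \matrix_(s < n, t < n) (z s == nth (0, 0)%N l t)%:R : 'M[rat]_n.
pose B := \matrix_(s < n, t < n)
  (shiftc h k (z s) == nth (0, 0)%N l t)%:R : 'M[rat]_n.
transitivity (\sum_s \det (\matrix_(i, j) (if i == s then B i j else A i j))).
  apply: eq_bigr => s _; congr (\det _); apply/matrixP => i j; rewrite !mxE.
  by rewrite [in LHS]val_eqE; case: ifP.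
rewrite sum_det_row_col big1 // => t _.
set q := nth (0, 0)%N l t.
have sc_inj p p' : shiftc h k p = shiftc h k p' -> p = p'.
  by case: p p' => [p1 p2] [p1' p2'] [/addIn -> /addIn ->].
have [/andP[le1 le2]|Nle] := boolP ((h <= q.1)%N && (k <= q.2)%N); last first.
  apply: (@det0_col _ _ _ t) => s; rewrite !mxE eqxx -/q.
  by case: eqP => // E; case/negP: Nle; rewrite -E /= !leq_addl.
pose p := (q.1 - h, q.2 - k)%N.
have pE : shiftc h k p = q by rewrite /shiftc /= !subnK //; case: (q).
have pl : p \in l by apply: dl; rewrite pE mem_nth ?szl.
have [t' lt_t' pE'] : exists2 t', (t' < n)%N & p = nth (0, 0)%N l t'.
  by exists (index p l); rewrite -?szl ?index_mem ?nth_index.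
have Ntt' : t != Ordinal lt_t'.
  apply/eqP => tE; have : p = q by rewrite /q tE.
  rewrite -pE => /(congr1 (fun p => p.1 + p.2)%N) /=; lia.
rewrite -det_tr; apply: (determinant_alternate Ntt') => s.
rewrite !mxE eqxx [_ == t]eq_sym (negbTE Ntt') -/q -pE /= -pE'; congr (_%:R).
by congr nat_of_bool; apply/eqP/eqP => [/sc_inj|->].
Qed.

(** * Labels of the basis elements *)

Section Shapes.
Local Open Scope nat_scope.
Variable K : nat.

(** With row lengths given by a function that vanishes from [K] on, corners can be removed by [dec]
    while [K] stays fixed. *)
Definition shape (nu : nat -> nat) : Prop :=
  {homo nu : r r' / r <= r' >-> r' <= r} /\ forall r, K <= r -> nu r = 0.

(** For a shape this is the conjugate partition: the index of the first row of length at most [c] is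
    the height of column [c]. *)
Definition colh (nu : nat -> nat) c := find (fun r => nu r <= c) (iota 0 K).

Lemma ltn_colh nu r c : shape nu -> (r < colh nu c) = (c < nu r).
Proof.
case=> mono nu0; rewrite /colh; set p := fun r => _.
have [hasp|/hasNfind] := boolP (has p (iota 0 K)).
  have fK : find p (iota 0 K) < K by rewrite -[X in _ < X](size_iota 0) -has_find.
  have := nth_find 0 hasp; rewrite nth_iota // add0n {1}/p => Hf; case: (ltnP r) => [lt_r|le_r].
    have := before_find 0 lt_r; rewrite nth_iota; first by rewrite /p add0n leqNgt => /negbFE ->.
    by apply: leq_trans lt_r _; rewrite -[X in _ <= X](size_iota 0) find_size.
  by apply/esym/negbTE; rewrite -leqNgt; apply: leq_trans Hf; apply: mono.
move=> fE; case: (ltnP r) => [lt_r|].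
  have := before_find 0 lt_r; rewrite nth_iota; first by rewrite /p add0n leqNgt => /negbFE ->.
  by rewrite fE size_iota in lt_r.
by rewrite fE size_iota => /nu0 ->.
Qed.

Lemma colh_unique nu c x : shape nu -> (forall r, (r < x) = (c < nu r)) ->
  colh nu c = x.
Proof.
move=> sh H; apply/eqP; rewrite eqn_leq leqNgt ltn_colh // -H ltnn /=.
by rewrite leqNgt H -ltn_colh // ltnn.
Qed.

(** Besides removing a cell from a shape, this removes one occurrence of the letter [a] from the
    content of a word. *)
Definition dec (nu : nat -> nat) a r := nu r - (r == a).

Lemma shape_dec nu a : shape nu -> nu a.+1 < nu a -> shape (dec nu a).
Proof.
case=> mono nu0 lt_a; split=> [r r' le_rr'|r leK]; last by rewrite /dec nu0.
have := mono _ _ le_rr'; rewrite /dec.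
have [rE|_] := eqVneq r a; have [r'E|r'N] := eqVneq r' a => //=; try lia.
by have [le|/mono] := leqP r' a; rewrite ?rE; lia.
Qed.

(** For a nonempty row [r], the topmost row meeting its last column: the last row of the same
    length, which ends in a corner. *)
Definition lrow nu r := (colh nu (nu r).-1).-1.

Lemma lrowP nu r : shape nu -> 0 < nu r ->
  [/\ r <= lrow nu r, nu (lrow nu r) = nu r,
      nu (lrow nu r).+1 < nu (lrow nu r) & lrow nu r < K].
Proof.
move=> sh nur; case: (sh) => mono nu0; rewrite /lrow.
have H r' : (r' < colh nu (nu r).-1) = (nu r <= nu r') by rewrite ltn_colh // prednK.
have le_r : r < colh nu (nu r).-1 by rewrite H.
have [h hE] : exists h, colh nu (nu r).-1 = h.+1 by exists (colh nu (nu r).-1).-1; lia.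
rewrite hE /= in le_r H *.
have := H h; rewrite ltnS leqnn => /esym le_h.
have nuh : nu h = nu r by apply/eqP; rewrite eqn_leq le_h mono.
split=> //; first by rewrite nuh ltnNge -H ltnn.
by rewrite ltnNge; apply/negP => /nu0; lia.
Qed.

Lemma lrow_last nu a : shape nu -> nu a.+1 < nu a -> lrow nu a = a.
Proof.
move=> sh lt_a; rewrite /lrow (@colh_unique _ _ a.+1) // => r.
rewrite ltnS prednK; last exact: leq_ltn_trans lt_a.
have [mono _] := sh; case: leqP => [/mono -> //|/mono].
by move=> le1; apply/esym/negbTE; rewrite -ltnNge; apply: leq_ltn_trans lt_a.
Qed.

Lemma sum_dec nu a n : a < K -> 0 < nu a ->
  \sum_(r < K) nu r = n.+1 -> \sum_(r < K) dec nu a r = n.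
Proof.
move=> lt_a nua; rewrite (bigD1 (Ordinal lt_a)) //= => E.
rewrite (bigD1 (Ordinal lt_a)) //= {1}/dec eqxx.
rewrite (eq_bigr (fun r : 'I_K => nu r)); first by lia.
move=> r rN; rewrite /dec; case: eqP => [rE|]; last by rewrite subn0.
by case/eqP: rN; apply: val_inj.
Qed.

Lemma colh_dec nu a c : shape nu -> nu a.+1 < nu a ->
  colh nu c = colh (dec nu a) c + (c == (nu a).-1).
Proof.
move=> sh lt_a; have shd := shape_dec sh lt_a; have [mono _] := sh.
apply: colh_unique => // r.
have aE : c = (nu a).-1 -> colh (dec nu a) c = a.
  move=> ->; apply: colh_unique => // r'; rewrite /dec.
  have [->|r'N] := eqVneq r' a; first by rewrite ltnn; lia.
  rewrite subn0; case: ltnP => [/ltnW/mono|le_r']; first by lia.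
  have /mono : a < r' by rewrite ltn_neqAle eq_sym r'N.
  lia.
have [cE|cN] := eqVneq c (nu a).-1.
  by rewrite aE // addn1 ltnS cE; have [le|le] := leqP r a; have := mono _ _ le; lia.
rewrite addn0 ltn_colh // /dec; have [->|] := eqVneq r a; last by rewrite subn0.
lia.
Qed.

(* The s-th item of a label is the pair of the column of the entry s of a
   tableau and of the exponent m_s. *)
Notation lab := (seq (nat * nat)).

Definition lcol (lam : lab) s := (nth (0, 0) lam s).1.
Definition lexp (lam : lab) s := (nth (0, 0) lam s).2.
(** Entries fill each column from the bottom, so the row of [s] is the number of earlier entries in
    its column. *)
Definition lcell (lam : lab) s : cell :=
  (count_mem (lcol lam s) (unzip1 (take s lam)), lcol lam s).
Definition lcells (lam : lab) := mkseq (lcell lam) (size lam).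

Lemma size_lcells lam : size (lcells lam) = size lam.
Proof. exact: size_mkseq. Qed.

Lemma lcells_rcons lam x :
  lcells (rcons lam x) = rcons (lcells lam) (count_mem x.1 (unzip1 lam), x.1).
Proof.
rewrite /lcells size_rcons /mkseq -addn1 iotaD add0n map_cat cats1; congr rcons.
  apply/eq_in_map => s; rewrite mem_iota add0n /= => lt_s.
  by rewrite /lcell /lcol nth_rcons lt_s -cats1 takel_cat // ltnW.
by rewrite /lcell /lcol nth_rcons ltnn eqxx -cats1 take_size_cat.
Qed.

(* Instead of a corner (a, b) and of an index u, the last item is obtained from a
   row r: a is the last row as long as row r, and u = i + (a - r). *)
Definition labs_step (L : (nat -> nat) -> seq lab) nu i j : seq lab :=
  [seq rcons lam ((nu r).-1, i + lrow nu r - r)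
     | r <- [seq r <- iota 0 K | (i <= r) && (j < nu r)],
       lam <- L (dec nu (lrow nu r))].

Fixpoint labs n nu : seq lab :=
  if n is n'.+1 then labs_step (labs n') nu 0 0 else [:: [::]].

(** In [labs] the second coordinate of an item is an exponent; in the last item here it is the row
    [u] of the hole. One step produces both, since a hole in row [u] behaves as an additional
    variable differentiated [u] times and taken at exponent 0. *)
Definition labs_from n := labs_step (labs n).

Lemma labs_fromP n nu i j lam' : reflect
  (exists r lam, [/\ i <= r, r < K, j < nu r, lam \in labs n (dec nu (lrow nu r))
      & lam' = rcons lam ((nu r).-1, i + lrow nu r - r)])
  (lam' \in labs_from n nu i j).
Proof.
apply: (iffP allpairsPdep) => [[r [lam [rI lamI ->]]]|[r [lam [ir rK jr lamI ->]]]].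
  exists r, lam; move: rI; rewrite mem_filter mem_iota.
  by case/andP=> /andP[-> ->] /andP[_ ->].
by exists r, lam; rewrite mem_filter mem_iota ir jr.
Qed.

Definition fills n nu (lam : lab) : Prop :=
  [/\ size lam = n, forall c, count_mem c (unzip1 lam) = colh nu c,
      uniq (lcells lam) & forall p, (p \in lcells lam) = (p.2 < nu p.1)].

(** Column [(nu a).-1] of [dec nu a] has height [a], so the new item lands exactly in the removed
    corner. *)
Lemma fills_rcons n nu a k lam : shape nu -> nu a.+1 < nu a ->
  fills n (dec nu a) lam ->
  fills n.+1 nu (rcons lam ((nu a).-1, k)) /\
  lcells (rcons lam ((nu a).-1, k)) = rcons (lcells lam) (a, (nu a).-1).
Proof.
move=> sh lt_a [sz cnt ul mem].
have a_gt0 : 0 < nu a by apply: leq_ltn_trans lt_a.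
have shd := shape_dec sh lt_a.
have cntE : colh (dec nu a) (nu a).-1 = a.
  apply: colh_unique => // r'; rewrite /dec.
  have [mono _] := sh; have [->|r'N] := eqVneq r' a; first by rewrite ltnn; lia.
  rewrite subn0; case: ltnP => [/ltnW/mono|le_r']; first by lia.
  have /mono : a < r' by rewrite ltn_neqAle eq_sym r'N.
  lia.
have cellsE : lcells (rcons lam ((nu a).-1, k)) = rcons (lcells lam) (a, (nu a).-1).
  by rewrite lcells_rcons /= cnt cntE.
split=> //; split; first by rewrite size_rcons sz.
- move=> c; rewrite /unzip1 map_rcons -cats1 count_cat -/unzip1 cnt /= addn0.
  by rewrite (colh_dec c sh lt_a) eq_sym.
- rewrite cellsE rcons_uniq ul andbT mem /dec eqxx /=; lia.
move=> p; rewrite cellsE mem_rcons inE mem /dec.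
case: p => r' c /=; have [->|r'N] := eqVneq r' a.
  rewrite xpair_eqE eqxx /=; lia.
by rewrite xpair_eqE (negbTE r'N) subn0.
Qed.

Lemma labs_fills n nu lam : shape nu -> \sum_(r < K) nu r = n ->
  lam \in labs n nu -> fills n nu lam.
Proof.
elim: n nu lam => [|n IHn] nu lam sh sum_nu.
  rewrite inE => /eqP ->.
  have nu0 r : nu r = 0.
    case: (ltnP r K) => [lt_r|]; last by case: sh => _; apply.
    by move/eqP: sum_nu; rewrite sum_nat_eq0 => /forallP /(_ (Ordinal lt_r)) /eqP.
  split=> // [c|p]; last by rewrite nu0.
  by apply/esym/colh_unique => // r; rewrite nu0.
case/labs_fromP => r [lam1 [_ rK nur lam1I ->]].
have [le_r nua lt_a aK] := lrowP sh nur.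
have a_gt0 := leq_ltn_trans (leq0n _) lt_a.
rewrite -nua; apply: (proj1 (fills_rcons _ sh lt_a _)).
exact: IHn (shape_dec sh lt_a) (sum_dec aK a_gt0 sum_nu) lam1I.
Qed.

Lemma labs_from_fills n nu i j lam : shape nu -> \sum_(r < K) nu r = n.+1 ->
  lam \in labs_from n nu i j -> fills n.+1 nu lam.
Proof.
move=> sh sum_nu /labs_fromP[r [lam1 [_ rK jr lam1I ->]]].
have [le_r nua lt_a aK] := lrowP sh (leq_ltn_trans (leq0n j) jr).
have a_gt0 := leq_ltn_trans (leq0n _) lt_a.
rewrite -nua; apply: (proj1 (fills_rcons _ sh lt_a _)).
exact: labs_fills (shape_dec sh lt_a) (sum_dec aK a_gt0 sum_nu) lam1I.
Qed.

(** The last item determines [r]: its column gives the length of row [r], hence [lrow], and its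
    second coordinate then gives [r]. *)
Lemma uniq_labs_step L nu i j : shape nu ->
  (forall a, nu a.+1 < nu a -> uniq (L (dec nu a))) ->
  uniq (labs_step L nu i j).
Proof.
move=> sh uL; apply: allpairs_uniq_dep; first by rewrite filter_uniq ?iota_uniq.
  move=> r; rewrite mem_filter => /andP[/andP[_ jr] _]; apply: uL.
  by case: (lrowP sh (leq_ltn_trans (leq0n j) jr)).
move=> _ _ /allpairsPdep[r [lam [rI lamI ->]]] /allpairsPdep[r' [lam' [r'I lamI' ->]]].
move: rI r'I; rewrite !mem_filter !mem_iota add0n /= => /andP[/andP[ir jr] rK] /andP[/andP[ir' jr'] r'K] /=.
move/eqP; rewrite eqseq_rcons xpair_eqE => /andP[/eqP -> /andP[/eqP E1 /eqP E2]].
have nuE : nu r = nu r' by lia.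
have [le1 _ _ _] := lrowP sh (leq_ltn_trans (leq0n j) jr).
have [le2 _ _ _] := lrowP sh (leq_ltn_trans (leq0n j) jr').
have -> // : r = r'.
have : lrow nu r = lrow nu r' by rewrite /lrow nuE.
lia.
Qed.

Lemma uniq_labs n nu : shape nu -> uniq (labs n nu).
Proof.
elim: n nu => //= n IHn nu sh.
by apply: uniq_labs_step => // a lt_a; apply/IHn/shape_dec.
Qed.

Lemma uniq_labs_from n nu i j : shape nu -> uniq (labs_from n nu i j).
Proof.
by move=> sh; apply: uniq_labs_step => // a lt_a; apply/uniq_labs/shape_dec.
Qed.

End Shapes.

(** * Linear independence *)

Section Independence.
Variable K : nat.
Notation lab := (seq (nat * nat)).

(* Up to a nonzero factor that depends only on lam, this is m! times the
   coefficient of x^m in the polynomial labelled by lam. For a label in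
   [labs_from n nu i j] the polynomial has n variables, and [m n] is to be 0. *)
Definition lcoef (lam : lab) (m : nat -> nat) : rat :=
  incid (size lam) (fun s => (m s + lexp lam s, lcol lam s)%N) (lcells lam).

Definition incr (m : nat -> nat) s t : nat := (m t + (t == s))%N.

Lemma eq_lcoef lam m m' : (forall s, (s < size lam)%N -> m s = m' s) ->
  lcoef lam m = lcoef lam m'.
Proof. by move=> H; apply: eq_incid => s lt_s; rewrite H. Qed.

Lemma lcoef_rcons lam b k m : lcoef (rcons lam (b, k)) m =
  incid (size lam).+1 (fun s => if (s < size lam)%N
    then (m s + lexp lam s, lcol lam s)%N else (m (size lam) + k, b)%N)
  (lcells (rcons lam (b, k))).
Proof.
rewrite /lcoef size_rcons; apply: eq_incid => s; rewrite ltnS => le_s.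
rewrite /lexp /lcol nth_rcons; case: ltngtP le_s => // -> _.
by rewrite /=.
Qed.

(** Raising one exponent moves one cell up by a row, and a diagram is closed under moving cells
    down. *)
Lemma sum_lcoef_incr n nu lam m : shape K nu -> fills K n nu lam ->
  \sum_(s < n) lcoef lam (incr m s) = 0.
Proof.
move=> sh [sz _ ul mem].
rewrite -[RHS](@incid_move n (fun s => (m s + lexp lam s, lcol lam s)%N)
  (lcells lam) 1 0) // ?size_lcells //.
  apply: eq_bigr => s _; rewrite /lcoef sz; apply: eq_incid => s' _.
  by rewrite /incr /shiftc /=; case: eqP; rewrite ?addn0 // addnAC.
move=> [r c]; rewrite !mem /shiftc /= addn0 => H.
by apply: leq_trans H _; case: sh => mono _; apply: mono; rewrite addn1.
Qed.

(* The derivation sum_s d/dx_s kills the Garnir polynomials of the full shape,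
   so a relation among the coefficients of [x_n ^ k] yields the same relation
   for [x_n ^ (k + 1)]. *)
Lemma relation_all n nu (L : seq lab) a : shape K nu ->
  (forall lam, lam \in L -> fills K n.+1 nu lam) ->
  (forall m, m n = 0%N -> \sum_(lam <- L) a lam * lcoef lam m = 0) ->
  forall m, \sum_(lam <- L) a lam * lcoef lam m = 0.
Proof.
move=> sh HL H m; have [k mk] : exists k, m n = k by exists (m n).
elim: k m mk => [|k IHk] m mk; first exact: H.
pose m' t := (m t - (t == n))%N.
have Em : \sum_(lam <- L) a lam * lcoef lam m =
          \sum_(lam <- L) a lam * lcoef lam (incr m' n).
  apply: eq_bigr => lam _; congr (_ * _); apply: eq_lcoef => s _.
  by rewrite /incr /m'; case: eqP => [->|]; lia.
have : \sum_(s < n.+1) \sum_(lam <- L) a lam * lcoef lam (incr m' s) = 0.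
  rewrite exchange_big big_seq big1 //= => lam lamL.
  by rewrite -mulr_sumr (sum_lcoef_incr _ sh (HL _ lamL)) mulr0.
rewrite big_ord_recr /= -Em big1 ?add0r // => s _; apply: IHk.
by rewrite /incr /m' eqxx mk eq_sym (ltn_eqF (ltn_ord s)); lia.
Qed.

(** [Q] selects the exponents on which a relation is tested; with [m n = 0] this is independence as
    polynomials in the first [n] variables. *)
Definition free_family (T : eqType) (L : seq T) (f : T -> (nat -> nat) -> rat)
    (Q : (nat -> nat) -> Prop) : Prop :=
  forall a : T -> rat, (forall m, Q m -> \sum_(x <- L) a x * f x m = 0) ->
  forall x, x \in L -> a x = 0.

(** The last row of the incidence matrix is then the corner itself; expanding along it leaves the
    smaller shape. *)
Lemma lcoef_top n nu a lam m : shape K nu -> (nu a.+1 < nu a)%N ->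
  fills K n (dec nu a) lam -> forall k, (m n + k = a)%N ->
  lcoef (rcons lam ((nu a).-1, k)) m = lcoef lam m.
Proof.
move=> sh lt_a fl k mE; have [[_ _ ul _] cE] := fills_rcons k sh lt_a fl.
have [sz _ _ _] := fl; rewrite cE in ul.
rewrite lcoef_rcons sz cE incid_rcons ?size_lcells ?ltnn ?mE // /lcoef sz.
by apply: eq_incid => s ->.
Qed.

(** The last row of the incidence matrix is then a cell above the corner, outside the diagram. *)
Lemma lcoef_above n nu a lam m : shape K nu -> (nu a.+1 < nu a)%N ->
  fills K n (dec nu a) lam -> forall k, (a < m n + k)%N ->
  lcoef (rcons lam ((nu a).-1, k)) m = 0.
Proof.
move=> sh lt_a fl k lt_ak; have [[sz1 _ ul mem] _] := fills_rcons k sh lt_a fl.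
have [sz _ _ _] := fl.
rewrite lcoef_rcons sz (@incid_notin _ _ _ n) ?size_lcells ?ltnn ?mem //=.
have [mono _] := sh; move/mono: lt_ak; lia.
Qed.

(** Once the relation is extended to all exponents of [x_n], the labels are eliminated row by row,
    from the largest [r] down. Those of the row being treated reduce to the smaller shape, where
    [IH] applies. *)
Lemma labs_from_free_step n nu i j : shape K nu -> (\sum_(r < K) nu r = n.+1)%N ->
  (forall nu', shape K nu' -> (\sum_(r < K) nu' r = n)%N ->
    free_family (labs K n nu') lcoef (fun=> True)) ->
  free_family (labs_from K n nu i j) lcoef (fun m => m n = 0%N).
Proof.
move=> sh sum_nu IH a /(relation_all sh (fun lam => labs_from_fills sh sum_nu)) H.
have Ha : forall k r lam, (K <= k + r)%N -> (i <= r)%N -> (j < nu r)%N ->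
    (r < K)%N -> lam \in labs K n (dec nu (lrow K nu r)) ->
    a (rcons lam ((nu r).-1, i + lrow K nu r - r)%N) = 0.
  elim=> [|k IHk] r lam; first by rewrite add0n leqNgt => /negbTE ->.
  move=> leK ir jr rK; have [le_r nua lt_a aK] := lrowP sh (leq_ltn_trans (leq0n j) jr).
  have a_gt0 := leq_ltn_trans (leq0n _) lt_a.
  have shd := shape_dec sh lt_a; have sumd := sum_dec aK a_gt0 sum_nu.
  move: lam; apply: IH => // m _.
  (* With this exponent, the last cell of a label of row [r'] lies in row [lrow r' + (r - r')]: in
     the corner for [r' = r], above it for [r' < r]. The labels with [r' > r] already have
     coefficient 0. *)
  pose m' t := if t == n then (r - i)%N else m t.
  have := H m'; rewrite /labs_from /labs_step big_allpairs_dep /=.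
  rewrite (bigD1_seq r) /=; last 2 first.
  - by rewrite mem_filter ir jr mem_iota.
  - by rewrite filter_uniq ?iota_uniq.
  rewrite [X in _ + X]big_seq_cond [X in _ + X]big1 ?addr0 => [E|r'].
    rewrite -[RHS]E.
    rewrite big_seq [RHS]big_seq; apply: eq_bigr => lam lamL; congr (_ * _).
    have fl := labs_fills shd sumd lamL.
    rewrite -nua (lcoef_top sh lt_a fl); last by rewrite /m' eqxx; lia.
    apply: eq_lcoef => s; have [-> _ _ _] := fl.
    by rewrite /m'; case: eqP => // ->; rewrite ltnn.
  rewrite mem_filter mem_iota /= add0n => /andP[/andP[/andP[ir' jr'] r'K] r'N].
  have [le_r' nua' lt_a' aK'] := lrowP sh (leq_ltn_trans (leq0n j) jr').
  have a'_gt0 := leq_ltn_trans (leq0n _) lt_a'.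
  rewrite big_seq big1 // => lam lamL; case: (ltngtP r' r) r'N => // lt_r _.
    have fl := labs_fills (shape_dec sh lt_a') (sum_dec aK' a'_gt0 sum_nu) lamL.
    by rewrite -nua' (lcoef_above sh lt_a' fl) ?mulr0 // /m' eqxx; lia.
  by rewrite IHk ?mul0r //; lia.
by move=> _ /labs_fromP[r [lam [ir rK jr lamL ->]]]; apply: (Ha K) => //; lia.
Qed.

Lemma labs_free n nu : shape K nu -> (\sum_(r < K) nu r = n)%N ->
  free_family (labs K n nu) lcoef (fun=> True).
Proof.
elim: n nu => [|n IHn] nu sh sum_nu a H.
  move=> lam; rewrite inE => /eqP ->.
  by have := H (fun=> 0%N) I; rewrite big_seq1 /lcoef /incid det_mx00 mulr1.
by apply: (labs_from_free_step sh sum_nu IHn) => m _; apply: H.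
Qed.

Lemma labs_from_free n nu i j : shape K nu -> (\sum_(r < K) nu r = n.+1)%N ->
  free_family (labs_from K n nu i j) lcoef (fun m => m n = 0%N).
Proof. by move=> sh sum_nu; apply: labs_from_free_step (@labs_free n). Qed.

End Independence.

(** * Counting words and labels *)

Section Counting.
Local Open Scope nat_scope.
Variable K : nat.

(** Counts the words of length [n] using each letter [r] at most [kappa r] times, by their last
    letter; if [kappa] has sum [n], this is a multinomial coefficient. *)
Fixpoint nwords n (kappa : nat -> nat) : nat :=
  if n is n'.+1 then \sum_(r < K | 0 < kappa r) nwords n' (dec kappa r) else 1.

Lemma nwords_perm n (kappa kappa' : nat -> nat) (p : 'S_K) :
  (forall r : 'I_K, kappa' r = kappa (p r)) -> nwords n kappa' = nwords n kappa.
Proof.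
elim: n kappa kappa' => //= n IHn kappa kappa' H.
rewrite [RHS](reindex_inj (@perm_inj _ p)) /=.
apply: eq_big => r; first by rewrite H.
move=> _; apply: IHn => r'; rewrite /dec H; congr (_ - nat_of_bool _).
by rewrite !val_eqE (inj_eq perm_inj).
Qed.

(** The two contents differ by the transposition of [a] and [b]. *)
Lemma nwords_dec n (kappa : nat -> nat) a b : a < K -> b < K -> kappa a = kappa b ->
  nwords n (dec kappa a) = nwords n (dec kappa b).
Proof.
move=> aK bK E; apply: (@nwords_perm _ _ _ (tperm (Ordinal aK) (Ordinal bK))).
move=> r; rewrite /dec; case: tpermP => [->|->|/eqP rNa /eqP rNb] /=.
- by rewrite !eqxx E.
- by rewrite [b == a]eq_sym E.
by move: rNa rNb; rewrite -!val_eqE /= => /negbTE -> /negbTE ->.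
Qed.

(** Labels remove a cell from the corner row [lrow r], words a letter from row [r] itself; the
    counts agree because the two rows have the same length. *)
Lemma size_labs_step L f nu i j : shape K nu ->
  (forall a, nu a.+1 < nu a -> size (L (dec nu a)) = f (dec nu a)) ->
  (forall a b, a < K -> b < K -> nu a = nu b -> f (dec nu a) = f (dec nu b)) ->
  size (labs_step K L nu i j) = \sum_(r < K | (i <= r) && (j < nu r)) f (dec nu r).
Proof.
move=> sh HL Hf; rewrite size_allpairs_dep sumnE big_map big_filter.
have -> : iota 0 K = index_iota 0 K by rewrite /index_iota subn0.
rewrite big_mkord; apply: eq_bigr => r /andP[_ jr].
have [_ nua lt_a aK] := lrowP sh (leq_ltn_trans (leq0n j) jr).
by rewrite HL // (Hf _ r).
Qed.

Lemma size_labs n nu : shape K nu -> size (labs K n nu) = nwords n nu.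
Proof.
elim: n nu => //= n IHn nu sh.
rewrite (@size_labs_step _ (nwords n)) //; first by move=> a lt_a; apply/IHn/shape_dec.
exact: nwords_dec.
Qed.

Lemma size_labs_from n nu i j : shape K nu -> size (labs_from K n nu i j) =
  \sum_(r < K | (i <= r) && (j < nu r)) nwords n (dec nu r).
Proof.
move=> sh; apply: size_labs_step => //; last exact: nwords_dec.
by move=> a lt_a; apply/size_labs/shape_dec.
Qed.

Definition words_step (W : (nat -> nat) -> seq (seq 'I_K)) (P : pred 'I_K) kappa
    : seq (seq 'I_K) :=
  [seq rcons w r | r : 'I_K <- enum P, w : seq 'I_K <- W (dec kappa r)].

Fixpoint words n kappa : seq (seq 'I_K) :=
  if n is n'.+1 then words_step (words n') [pred r : 'I_K | 0 < kappa r] kappa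
  else [:: [::]].

Lemma size_words n kappa : size (words n kappa) = nwords n kappa.
Proof.
elim: n kappa => //= n IHn kappa; rewrite size_allpairs_dep sumnE big_map.
by rewrite big_enum_cond /=; apply: eq_big => // r; rewrite andbT.
Qed.

Lemma mem_words n (kappa : nat -> nat) (w : seq 'I_K) : size w = n ->
  (forall r : 'I_K, count_mem r w = kappa r) -> w \in words n kappa.
Proof.
elim: n kappa w => [|n IHn] kappa w; first by move/size0nil => ->.
case/lastP: w => // w x; rewrite size_rcons => -[szw] H.
have Hx (r : 'I_K) : kappa r = count_mem r w + (x == r) by rewrite -H -cats1 count_cat /= addn0.
apply/allpairsPdep; exists x, w; split=> //.
  by rewrite mem_enum inE Hx eqxx addn1.
by apply: IHn => // r; rewrite /dec Hx val_eqE eq_sym addnK.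
Qed.

Definition content_pts n (nu : nat -> nat) i j : {set n.-tuple 'I_K} :=
  [set w : n.-tuple 'I_K | [exists r0 : 'I_K, [&& i <= r0, j < nu r0
    & [forall r : 'I_K, count_mem r w == dec nu r0 r]]]].

(** The points occur among the pairs of an admissible row [r0] and a word of content [dec nu r0],
    and there are as many such pairs as labels. This is the upper bound on the dimension. *)
Lemma card_content_pts n nu i j : shape K nu ->
  #|content_pts n nu i j| <= size (labs_from K n nu i j).
Proof.
move=> sh; rewrite size_labs_from //.
pose W := [seq w | r : 'I_K <- enum [pred r : 'I_K | (i <= r) && (j < nu r)],
                   w : seq 'I_K <- words n (dec nu r)].
have <- : size W = \sum_(r < K | (i <= r) && (j < nu r)) nwords n (dec nu r).
  rewrite size_allpairs_dep sumnE big_map big_enum_cond /=.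
  by apply: eq_big => r; rewrite ?andbT ?size_words.
rewrite cardE -(size_map (@tval n 'I_K)); apply: uniq_leq_size.
  by rewrite map_inj_uniq ?enum_uniq //; apply: val_inj.
move=> w' /mapP[w]; rewrite mem_enum inE => /existsP[r0 /and3P[ir0 jr0 /forallP H]] ->{w'}.
apply/allpairsPdep; exists r0, (tval w); rewrite mem_enum inE ir0 jr0; split=> //.
by apply: mem_words => [|r]; [rewrite size_tuple | apply/eqP/H].
Qed.

End Counting.

(** * Interpolation on words *)

Section Interpolation.
Variables K n : nat.

(** Falling factorials replace the monomials [w ^ m], from which they differ by terms of lower
    degree. *)
Definition ffev (w : n.-tuple 'I_K) (m : nat -> nat) : rat :=
  \prod_(s < n) ((tnth w s) ^_ (m s))%:R.

Definition ndeg (m : nat -> nat) : nat := (\sum_(s < n) m s)%N.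

(** [phi] is homogeneous of degree [d], and the weights [c] on [P] represent it up to that degree;
    in particular they annihilate all falling factorials of degree less than [d]. *)
Definition interpolable (P : {set n.-tuple 'I_K}) (phi : (nat -> nat) -> rat) :=
  exists d c,
    (forall m, (ndeg m <= d)%N -> phi m = \sum_(w in P) c w * ffev w m) /\
    (forall m, ndeg m != d -> phi m = 0).

Lemma eq_interpolable P phi psi :
  phi =1 psi -> interpolable P phi -> interpolable P psi.
Proof. by move=> E [d [c [H1 H2]]]; exists d, c; split=> m; rewrite -E; auto. Qed.

Lemma ndeg_incr m (s : 'I_n) : ndeg (incr m s) = (ndeg m).+1.
Proof.
rewrite /ndeg (bigD1 s) //= /incr eqxx addn1 addSn; congr _.+1.
rewrite [RHS](bigD1 s) //=; congr addn; apply: eq_bigr => t tNs.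
by rewrite val_eqE (negbTE tNs) addn0.
Qed.

Lemma ffev_incr w m (s : 'I_n) :
  ffev w (incr m s) = ((tnth w s)%:R - (m s)%:R) * ffev w m.
Proof.
rewrite /ffev (bigD1 s) //= [in RHS](bigD1 s) //= mulrA; congr (_ * _).
  rewrite /incr eqxx addn1 ffactnSr natrM mulrC.
  case: (leqP (m s) (tnth w s)) => [le|lt]; first by rewrite natrB.
  by rewrite ffact_small // !mulr0.
by apply: eq_bigr => t tNs; rewrite /incr val_eqE (negbTE tNs) addn0.
Qed.

(* Differentiation multiplies the interpolating weights by a coordinate, since
   w * w ^_ m = w ^_ m.+1 + m * w ^_ m and the second term has lower degree. *)
Lemma interpolable_incr P phi (s : 'I_n) :
  interpolable P phi -> interpolable P (fun m => phi (incr m s)).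
Proof.
case=> [[|d] [c [H1 H2]]].
  exists 0%N, (fun=> 0); split=> m _; last by rewrite H2 ?ndeg_incr.
  by rewrite H2 ?ndeg_incr // big1 // => w _; rewrite mul0r.
exists d, (fun w => c w * (tnth w s)%:R); split=> m Hm; last first.
  by rewrite H2 ?ndeg_incr // eqSS.
rewrite H1 ?ndeg_incr //; transitivity
  (\sum_(w in P) c w * (tnth w s)%:R * ffev w m - (m s)%:R * phi m); last first.
  by rewrite [phi m]H2 ?mulr0 ?subr0 // neq_ltn ltnS Hm.
rewrite H1; last exact: leqW.
rewrite mulr_sumr -sumrB; apply: eq_bigr => w _; rewrite ffev_incr; ring.
Qed.

(** Induction on the degree of [k], one differentiation at a time. *)
Lemma interpolable_shift P phi k :
  (forall m m', (forall s, (s < n)%N -> m s = m' s) -> phi m = phi m') ->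
  interpolable P phi -> interpolable P (fun m => phi (fun s => m s + k s)%N).
Proof.
move=> ext; move E: (ndeg k) => d; elim: d k E => [|d IHd] k degk int.
  apply: eq_interpolable int => m; apply: ext => s lt_s.
  move/eqP: degk; rewrite /ndeg sum_nat_eq0 => /forallP /(_ (Ordinal lt_s)) /eqP /= ->.
  by rewrite addn0.
have [s ks] : exists s : 'I_n, (0 < k s)%N.
  apply/existsP; apply: contraLR (ltn0Sn d) => /existsPn H; rewrite -degk /ndeg.
  by rewrite big1 // => s _; apply/eqP; rewrite -leqn0 leqNgt H.
pose k' t := (k t - (t == s :> nat))%N.
have kE t : k t = incr k' s t by rewrite /incr /k'; case: eqP => [->|]; lia.
have degk' : ndeg k' = d.
  apply: succn_inj; rewrite -degk -(ndeg_incr _ s).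
  by apply: eq_bigr => t _; rewrite kE.
apply: eq_interpolable (interpolable_incr s (IHd _ degk' int)) => m.
by apply: ext => t _; rewrite kE /incr; lia.
Qed.

End Interpolation.

(** * Incidence determinants with a fixed extra row are interpolable *)

Section IncidenceInterpolation.
Variables (K n : nat) (nu : nat -> nat) (l : seq cell).
Hypotheses (sh : shape K nu) (szl : size l = n.+1) (ul : uniq l).
Hypothesis meml : forall p, (p \in l) = (p.2 < nu p.1)%N.

Let r_ t := (nth (0, 0)%N l t).1.
Let c_ t := (nth (0, 0)%N l t).2.

Let lE t : nth (0, 0)%N l t = (r_ t, c_ t).
Proof. by rewrite /r_ /c_; case: nth. Qed.

Let c_lt (t : 'I_n.+1) : (c_ t < nu (r_ t))%N.
Proof. by rewrite -[(_ < _)%N](meml (r_ t, c_ t)) -lE mem_nth ?szl. Qed.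

Let r_lt (t : 'I_n.+1) : (r_ t < K)%N.
Proof.
by rewrite ltnNge; apply/negP => /(proj2 sh) E; have := c_lt t; rewrite E.
Qed.

(** Change of basis inside each column of the diagram: from indicators of cells to falling
    factorials evaluated at the rows. *)
Let falling : 'M[rat]_n.+1 :=
  \matrix_(t', t) ((c_ t' == c_ t)%:R * (r_ t ^_ r_ t')%:R).

(* A permutation with a nonzero contribution maps each cell weakly upwards in
   its column, so it is the identity. *)
Let det_falling : \det falling != 0.
Proof.
rewrite /determinant (bigD1 (1%g : 'S_n.+1)) //= [X in _ + X]big1 => [|p pN1].
  rewrite addr0 odd_perm1 mul1r prodf_seq_neq0; apply/allP => t _ /=.
  by rewrite perm1 mxE eqxx mul1r ffactnn pnatr_eq0 -lt0n fact_gt0.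
apply/eqP; rewrite mulf_eq0; apply/orP; right; apply: contraR pN1.
move/prodf_neq0 => Hp; apply/eqP/permP => t; rewrite perm1.
have Hp' (t' : 'I_n.+1) : (c_ t' == c_ (p t')) && (r_ t' <= r_ (p t'))%N.
  have := Hp t' isT; rewrite mxE mulf_eq0 negb_or !pnatr_eq0 eqb0 negbK.
  case/andP=> -> ff /=; rewrite leqNgt; apply: contra ff => lt.
  by rewrite ffact_small.
have rE : r_ t = r_ (p t).
  have /leqif_sum : forall t' : 'I_n.+1, true ->
      (r_ t' <= r_ (p t') ?= iff (r_ t' == r_ (p t')))%N.
    by move=> t' _; split=> //; case/andP: (Hp' t').
  case=> _; rewrite [X in (X == _)%N](reindex_perm p) eqxx.
  by move/esym/forallP/(_ t)/eqP.
have nthE : nth (0, 0)%N l (p t) = nth (0, 0)%N l t.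
  by rewrite !lE -rE; case/andP: (Hp' t) => /eqP -> _.
by apply/val_inj/eqP; rewrite -(nth_uniq (0, 0)%N _ _ ul) ?szl ?ltn_ord ?nthE.
Qed.

Let count_row r : count (fun p : cell => p.1 == r) l = nu r.
Proof.
have : perm_eq [seq p <- l | p.1 == r] [seq (r, c) | c <- iota 0 (nu r)].
  apply: uniq_perm; first exact: filter_uniq.
    by rewrite map_inj_uniq ?iota_uniq // => ? ? [].
  move=> [r' c]; rewrite mem_filter meml /=.
  apply/andP/mapP => [[/eqP -> lt]|[c' + [-> ->]]]; last by rewrite mem_iota.
  by exists c; rewrite // mem_iota.
by move/perm_size; rewrite size_filter size_map size_iota.
Qed.

Variables (i j u b : nat) (e : nat -> nat).
Hypotheses (iu : (i <= u)%N) (jb : (j <= b)%N).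

Let wrow (w : nat -> nat) (s t : nat) : rat :=
  if (s < n)%N then ((w s, e s) == nth (0, 0)%N l t)%:R
  else (b == c_ t)%:R * (r_ t ^_ u)%:R.

Let wdet (w : n.-tuple 'I_K) : rat :=
  \det (\matrix_(s < n.+1, t < n.+1) wrow (nth 0%N (map val w)) s t).

Let wnth (w : n.-tuple 'I_K) (s : 'I_n) : nth 0%N (map val w) s = tnth w s.
Proof. by rewrite (nth_map (tnth w s)) ?size_tuple // -tnth_nth. Qed.

(** A nonzero Leibniz term matches the first [n] rows with all cells but one, [t0]; the last row
    forces [t0] into column [b], in a row [>= u]. So [w] misses one occurrence of a row that is
    [>= i] and longer than [j]. *)
Let wdet_support w : wdet w != 0 -> w \in content_pts K n nu i j.
Proof.
case/det_neq0_perm => p Hp.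
have Hs (s : 'I_n) : (tnth w s : nat) = r_ (p (widen_ord (leqnSn n) s)).
  have := Hp (widen_ord (leqnSn n) s); rewrite mxE /wrow /= ltn_ord wnth lE.
  by rewrite pnatr_eq0 eqb0 negbK => /eqP[].
have := Hp ord_max; rewrite mxE /wrow /= ltnn mulf_eq0 negb_or !pnatr_eq0 eqb0 negbK.
set t0 := p ord_max => /andP[/eqP bE ff].
have le_u : (u <= r_ t0)%N.
  by rewrite leqNgt; apply: contra ff => lt; rewrite ffact_small.
rewrite inE; apply/existsP; exists (Ordinal (r_lt t0)).
rewrite (leq_trans iu le_u) (leq_ltn_trans jb) /= ?bE ?c_lt //.
apply/forallP => r; rewrite /dec -count_row.
have -> : count (fun q : cell => q.1 == r) l = (\sum_(t < n.+1) (r_ t == r))%N.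
  rewrite -sum1_count big_mkcond (big_nth (0, 0)%N) szl big_mkord.
  by apply: eq_bigr => t _; rewrite /r_; case: eqP.
rewrite (reindex_perm p) big_ord_recr /= -/t0 [_ == r_ t0]eq_sym addnK.
rewrite -sum1_count big_mkcond big_tuple; apply/eqP/eq_bigr => s _.
by rewrite -Hs val_eqE /=; case: ifP.
Qed.

(** Multiplication by [falling] replaces the indicator of a cell by a falling factorial of the rows,
    and multilinear expansion of the first [n] rows turns the result into a sum of
    [wdet w * ffev w m]. *)
Lemma interpolable_incid : interpolable (content_pts K n nu i j) (fun m =>
  incid n.+1 (fun s => if (s < n)%N then (m s, e s) else (u, b)) l).
Proof.
exists (\sum_(t < n.+1) r_ t - u)%N, (fun w => (\det falling)^-1 * wdet w).
split=> m Hm; last first.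
  (* When the determinant is nonzero, the [m s] together with [u] are the rows of all cells, which
     fixes the degree. *)
  apply: contraNeq Hm => /incid_neq0 [p Hp].
  rewrite (reindex_perm p) big_ord_recr /=.
  have := Hp ord_max; rewrite /= ltnn lE => -[<- _]; rewrite addnK.
  apply/eqP/eq_bigr => s _; have := Hp (widen_ord (leqnSn n) s).
  by rewrite /= ltn_ord lE => -[].
set z := fun s => _.
have -> : \sum_(w in content_pts K n nu i j)
    (\det falling)^-1 * wdet w * ffev w m =
    (\det falling)^-1 * \sum_w wdet w * ffev w m.
  rewrite mulr_sumr big_mkcond; apply: eq_bigr => w _; case: ifP => [_|/negbT wN].
    by rewrite mulrA.
  have [->|/wdet_support] := eqVneq (wdet w) 0; first by rewrite mul0r mulr0.
  by rewrite (negbTE wN).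
apply: (canRL (mulKf det_falling)).
(* The product of the incidence matrix and [falling]. For [z s] outside the diagram row [s] vanishes
   on both sides, as all cells of that column lie strictly below [z s]. *)
pose A : 'M[rat]_n.+1 :=
  \matrix_(s, t) (((z s).2 == c_ t)%:R * (r_ t ^_ (z s).1)%:R).
transitivity (\det A).
  rewrite mulrC /incid -det_mulmx; congr (\det _); apply/matrixP => s t.
  rewrite !mxE; have [zl|zNl] := boolP (z s \in l).
    have lt_t' : (index (z s) l < n.+1)%N by rewrite -[X in (_ < X)%N]szl index_mem.
    rewrite (bigD1 (Ordinal lt_t')) //= big1 => [|t' t'N]; last first.
      rewrite mxE; case: eqP => [zE|]; last by rewrite mul0r.
      case/negP: t'N; apply/eqP/val_inj; rewrite /= zE index_uniq ?szl //.
    by rewrite !mxE /= /c_ /r_ nth_index // eqxx mul1r addr0.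
  rewrite big1 => [|t' _]; last first.
    rewrite mxE; case: eqP => [zE|]; last by rewrite mul0r.
    by case/negP: zNl; rewrite zE mem_nth ?szl.
  move: zNl; rewrite meml; case: eqP => [->|]; last by rewrite mul0r.
  case: (leqP (z s).1 (r_ t)) => [/(proj1 sh) le|/ffact_small -> _]; last by rewrite mulr0.
  by rewrite (leq_trans (c_lt t) le).
rewrite /wdet /determinant.
under [RHS]eq_bigr do rewrite mulr_suml.
rewrite exchange_big; apply: eq_bigr => p _ /=.
under [RHS]eq_bigr do rewrite -mulrA.
rewrite -mulr_sumr; congr (_ * _); rewrite big_ord_recr /=.
(* An entry of [A] in row [s] is the sum over [r] of [F s r], with at most one nonzero term;
   distributing the product over [s] creates the sum over words. *)
pose F (s : 'I_n) (r : 'I_K) : rat :=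
  ((r : nat, e s) == nth (0, 0)%N l (p (widen_ord (leqnSn n) s)))%:R * (r ^_ (m s))%:R.
transitivity ((\sum_(w : n.-tuple 'I_K) \prod_s F s (tnth w s)) * A ord_max (p ord_max)).
  congr (_ * _); rewrite (reindex (fun f : {ffun 'I_n -> 'I_K} => [tuple f s | s < n])) /=.
    rewrite [RHS](eq_bigr (fun f : {ffun 'I_n -> 'I_K} => \prod_s F s (f s))); last first.
      by move=> f _; apply: eq_bigr => s _; rewrite tnth_mktuple.
    rewrite -bigA_distr_bigA; apply: eq_bigr => s _.
    set t := p _; rewrite mxE /z /= ltn_ord.
    rewrite (bigD1 (Ordinal (r_lt t))) //= big1 => [|r rN]; last first.
      rewrite /F -/t lE xpair_eqE; case: eqP => [rE|]; last by rewrite mul0r.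
      by case/eqP: rN; apply: val_inj.
    by rewrite /F -/t lE xpair_eqE eqxx addr0.
  exists (fun w : n.-tuple 'I_K => [ffun s => tnth w s]) => [f|w] _.
    by apply/ffunP => s; rewrite ffunE tnth_mktuple.
  by apply: eq_from_tnth => s; rewrite tnth_mktuple ffunE.
rewrite mulr_suml; apply: eq_bigr => w _.
rewrite [in RHS]big_ord_recr /= /ffev mulrAC; congr (_ * _);
  last by rewrite !mxE /wrow /z /= ltnn.
rewrite -big_split; apply: eq_bigr => s _.
by rewrite /F !mxE /wrow /= ltn_ord wnth.
Qed.

End IncidenceInterpolation.

(** * Spanning by comparison of dimensions *)

Section Spanning.
Variables K n : nat.

(* Weights on P are linearly dependent as soon as there are more of them than
   points; the lowest-degree part of a dependency between the weights is a
   dependency between the interpolated functions. *)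
Lemma interpolable_span (T : eqType) (P : {set n.-tuple 'I_K}) (L : seq T)
    (f : T -> (nat -> nat) -> rat) phi :
  uniq L -> (#|P| <= size L)%N -> free_family L f (fun=> True) ->
  (forall x, x \in L -> interpolable P (f x)) -> interpolable P phi ->
  exists a : T -> rat, forall m, phi m = \sum_(x <- L) a x * f x m.
Proof.
move=> uL cardP freeL intL intphi.
(* [phi] joins the family as its member of index [ord_max]. *)
pose N := size L; pose g (k : 'I_N.+1) : (nat -> nat) -> rat :=
  if unlift ord_max k is Some k' then f (tnth (in_tuple L) k') else phi.
have gmax : g ord_max = phi by rewrite /g unlift_none.
have glift k' : g (lift ord_max k') = f (tnth (in_tuple L) k') by rewrite /g liftK.
have int k : exists dc : nat * (n.-tuple 'I_K -> rat),
    (forall m, (ndeg n m <= dc.1)%N -> g k m = \sum_(w in P) dc.2 w * ffev w m) /\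
    (forall m, ndeg n m != dc.1 -> g k m = 0).
  have [d [c H]] : interpolable P (g k).
    rewrite /g; case: unlift => [k'|//]; apply: intL; exact: mem_tnth.
  by exists (d, c).
have [dc Hdc] := fin_all_exists int.
pose C : 'M[rat]_(N.+1, #|P|) := \matrix_(k, w) (dc k).2 (enum_val w).
have /rowV0Pn[lam /sub_kermxP lamC lamN0] : kermx C != 0.
  by rewrite kermx_eq0 -row_leq_rank -ltnNge ltnS (leq_trans (rank_leq_col C)).
have lamC' w : w \in P -> \sum_k lam 0 k * (dc k).2 w = 0.
  move=> wP; move/matrixP/(_ 0 (enum_rank_in wP w)): lamC; rewrite !mxE => E.
  rewrite -[RHS]E; apply: eq_bigr => k _.
  by rewrite mxE enum_rankK_in.
have [k1 k1N0] : exists k, lam 0 k != 0.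
  apply/existsP; apply: contraR lamN0 => /existsPn H; apply/eqP/rowP => k.
  by rewrite mxE; apply/eqP; rewrite -[_ == _]negbK H.
pose k0 := [arg min_(k < k1 | lam 0 k != 0) (dc k).1].
have [k0N0 k0min] : lam 0 k0 != 0 /\ forall k, lam 0 k != 0 -> ((dc k0).1 <= (dc k).1)%N.
  by rewrite /k0; case: arg_minnP => // k kN0 kmin; split=> // k' /kmin.
pose mu k := if (dc k).1 == (dc k0).1 then lam 0 k else 0.
have rel m : \sum_k mu k * g k m = 0.
  have [degm|Ndegm] := eqVneq (ndeg n m) (dc k0).1; last first.
    apply: big1 => k _; rewrite /mu; case: eqP => [E|]; last by rewrite mul0r.
    by rewrite (proj2 (Hdc k)) ?mulr0 // E.
  transitivity (\sum_k lam 0 k * \sum_(w in P) (dc k).2 w * ffev w m).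
    apply: eq_bigr => k _; rewrite /mu.
    have [E|NE] := eqVneq; first by rewrite (proj1 (Hdc k)) // degm E.
    have [->|kN0] := eqVneq (lam 0 k) 0; first by rewrite !mul0r.
    rewrite -(proj1 (Hdc k)); last by rewrite degm k0min.
    by rewrite (proj2 (Hdc k)) ?mul0r ?mulr0 // degm eq_sym.
  under eq_bigr do rewrite mulr_sumr.
  rewrite exchange_big big1 //= => w wP.
  under eq_bigr do rewrite mulrA.
  by rewrite -mulr_suml lamC' // mul0r.
pose coef (nu' : 'I_N -> rat) x := oapp nu' 0 (insub (index x L)).
have sumL (nu' : 'I_N -> rat) m : \sum_(x <- L) coef nu' x * f x m =
    \sum_k' nu' k' * g (lift ord_max k') m.
  rewrite big_tnth; apply: eq_bigr => k' _; rewrite glift; congr (_ * _).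
  have x0 : T := tnth (in_tuple L) k'.
  by rewrite /coef (tnth_nth x0) /= index_uniq // valK.
have relL m : \sum_k' mu (lift ord_max k') * g (lift ord_max k') m + mu ord_max * phi m = 0.
  rewrite -[RHS](rel m) (bigD1 ord_max) //= gmax addrC; congr (_ + _).
  rewrite (reindex_omap (lift ord_max) (unlift ord_max)) /=; last first.
    by move=> k; case: unliftP => [k' ->|->] //; rewrite eqxx.
  by apply: eq_bigl => k'; rewrite liftK eqxx eq_sym neq_lift.
(* If [phi] were absent from the relation, the independence of [L] would force the nonzero
   coefficient at [k0] to vanish. *)
have [mu0|muN0] := eqVneq (mu ord_max) 0.
  have H x : x \in L -> coef (fun k' => mu (lift ord_max k')) x = 0.
    by apply: freeL => m _; rewrite sumL -[RHS](relL m) mu0 mul0r addr0.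
  case/negP: k0N0; have -> : lam 0 k0 = mu k0 by rewrite /mu eqxx.
  case: (unliftP ord_max k0) => [k' ->|->]; last by rewrite mu0.
  have := H _ (mem_tnth k' (in_tuple L)).
  have x0 : T := tnth (in_tuple L) k'.
  by rewrite /coef (tnth_nth x0) /= index_uniq // valK /= => ->.
exists (coef (fun k' => - (mu ord_max)^-1 * mu (lift ord_max k'))) => m; rewrite sumL.
rewrite (eq_bigr (fun k' => - (mu ord_max)^-1 *
  (mu (lift ord_max k') * g (lift ord_max k') m))); last by move=> k' _; rewrite mulrA.
rewrite -mulr_sumr; apply: (mulfI muN0); rewrite mulrA mulrN mulfV // mulN1r.
by apply/eqP; rewrite -addr_eq0 addrC relL.
Qed.

(** Both sides are built from shifts of incidence determinants whose extra row [(u, b)] satisfies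
    [i <= u] and [j <= b], hence from interpolable functions; the labels are independent and at
    least as many as the points. *)
Lemma labs_from_span nu i j l e k : shape K nu -> (\sum_(r < K) nu r = n.+1)%N ->
  size l = n.+1 -> uniq l -> (forall p, (p \in l) = (p.2 < nu p.1)%N) ->
  exists a, forall m, m n = 0%N ->
    incid n.+1 (fun s => if (s < n)%N then (m s + k s, e s)%N else (i, j)) l =
    \sum_(lam <- labs_from K n nu i j) a lam * lcoef lam m.
Proof.
move=> sh sum_nu szl ul meml.
(* [lcoef] also reads [m n], which interpolation in [n] variables does not see; truncation sets it
   to 0. *)
pose tr (m : nat -> nat) s := if (s < n)%N then m s else 0%N.
have trE m s : m n = 0%N -> (s < n.+1)%N -> tr m s = m s.
  by rewrite /tr ltnS => mn; case: ltngtP => // ->.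
have shift_int l' x e' k' : size l' = n.+1 -> uniq l' ->
    (forall p, (p \in l') = (p.2 < nu p.1)%N) -> (i <= x.1)%N -> (j <= x.2)%N ->
    interpolable (content_pts K n nu i j) (fun m =>
      incid n.+1 (fun s => if (s < n)%N then (m s + k' s, e' s)%N else x) l').
  move=> szl' ul' meml' ix jx.
  apply: (@interpolable_shift _ _ _ (fun m => incid n.+1
    (fun s => if (s < n)%N then (m s, e' s)%N else x) l')).
    by move=> m m' E; apply: eq_incid => s _; case: ifP => // lt_s; rewrite E.
  by case: x ix jx => u b ix jx; apply: interpolable_incid.
have [|||||a Ha] := @interpolable_span _ (content_pts K n nu i j)
  (labs_from K n nu i j) (fun lam m => lcoef lam (tr m))
  (fun m => incid n.+1 (fun s => if (s < n)%N then (m s + k s, e s)%N else (i, j)) l).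
- exact: uniq_labs_from.
- exact: card_content_pts.
- move=> a H; apply: (labs_from_free sh sum_nu) => m mn.
  rewrite -[RHS](H m I); rewrite big_seq [RHS]big_seq; apply: eq_bigr => lam lamL.
  congr (_ * _); apply: eq_lcoef => s.
  by have [-> _ _ _] := labs_from_fills sh sum_nu lamL => lt_s; rewrite trE.
- move=> lam lamL; have [sz _ ul' meml'] := labs_from_fills sh sum_nu lamL.
  have := shift_int (lcells lam); rewrite size_lcells.
  case/labs_fromP: lamL sz ul' meml' => r [lam1 [ir rK jr lamL ->]] sz ul' meml'.
  have sz1 : size lam1 = n by move: sz; rewrite size_rcons => -[].
  move/(_ ((i + lrow K nu r - r)%N, (nu r).-1) (lcol lam1) (lexp lam1) sz ul' meml').
  have [le_r _ _ _] := lrowP sh (leq_ltn_trans (leq0n j) jr).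
  move=> H; apply: eq_interpolable (H _ _) => /=; [|lia|lia].
  move=> m; rewrite lcoef_rcons sz1; apply: eq_incid => s _.
  by rewrite /tr ltnn; case: ifP.
- by apply: shift_int.
exists a => m mn; rewrite Ha big_seq [RHS]big_seq; apply: eq_bigr => lam lamL.
congr (_ * _); apply: eq_lcoef => s.
by have [-> _ _ _] := labs_from_fills sh sum_nu lamL => lt_s; rewrite trE.
Qed.

End Spanning.

(** * Coefficients of lattice determinants and Garnir polynomials *)

(** Rows and columns undergo the same permutation, so the signs cancel. *)
Lemma det_mxsub_inj (R : comNzRingType) m n (h : 'I_m -> 'I_n) (B : 'M[R]_n) :
  m = n -> injective h -> \det (mxsub h h B) = \det B.
Proof.
move=> mn; subst m => h_inj.
have -> : mxsub h h B = row_perm (perm h_inj) (col_perm (perm h_inj) B).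
  by apply/matrixP => s t; rewrite !mxE !permE.
rewrite row_permE col_permE !det_mulmx !det_perm odd_permV.
by rewrite mulrCA -signr_addb addbb mulr1.
Qed.

(** Listing [g] before its complement makes the padded matrix block triangular, with an identity
    block. The padding keeps size [n], so that different blocks can be multiplied. *)
Lemma det_principal (R : comNzRingType) n (A : 'M[R]_n) (g : {set 'I_n}) :
  \det (\matrix_(s, t) if (s \in g) && (t \in g) then A s t else (s == t)%:R) =
  \det (\matrix_(s < #|g|, t < #|g|) A (enum_val s) (enum_val t)).
Proof.
set B := \matrix_(s, t) _.
pose h (x : 'I_(#|g| + #|~: g|)) :=
  match split x with inl a => enum_val a | inr b => enum_val b end.
have hl a : h (lshift _ a) = enum_val a by rewrite /h (unsplitK (inl a)).
have hr b : h (rshift _ b) = enum_val b by rewrite /h (unsplitK (inr b)).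
have gl (a : 'I_#|g|) : enum_val a \in g by apply: enum_valP.
have gr (b : 'I_#|~: g|) : enum_val b \notin g by have := enum_valP b; rewrite inE.
have h_inj : injective h.
  move=> x y; rewrite -[x]splitK -[y]splitK.
  case: (split x) (split y) => [a|a] [b|b] /=; rewrite ?hl ?hr.
  - by move/enum_val_inj ->.
  - by move=> E; case/negP: (gr b); rewrite -E gl.
  - by move=> E; case/negP: (gr a); rewrite E gl.
  by move/enum_val_inj ->.
rewrite -(det_mxsub_inj B _ h_inj); last by rewrite cardsC card_ord.
rewrite -[mxsub h h B]submxK.
have -> : dlsubmx (mxsub h h B) = 0.
  apply/matrixP => a b; rewrite !mxE hl hr (negbTE (gr a)) /=.
  by case: eqP => // E; case/negP: (gr a); rewrite E gl.
have -> : drsubmx (mxsub h h B) = 1%:M.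
  apply/matrixP => a b; rewrite !mxE !hr (negbTE (gr a)) /=.
  by rewrite (inj_eq enum_val_inj).
rewrite det_ublock det1 mulr1; congr (\det _).
by apply/matrixP => a b; rewrite !mxE !hl !gl.
Qed.

(** The blocks are split off one by one: the matrix [B (c :: cs)] is the padded block of [c] times
    [B cs]. *)
Lemma det_blocks (R : comNzRingType) n (T : eqType) (f : 'I_n -> T) (A : 'M[R]_n)
    (cs : seq T) : uniq cs -> (forall s, f s \in cs) ->
  (forall s t, f s != f t -> A s t = 0) ->
  \det A = \prod_(c <- cs)
    let g := [set s | f s == c] in
    \det (\matrix_(s < #|g|, t < #|g|) A (enum_val s) (enum_val t)).
Proof.
move=> ucs fcs A0.
have fneq s t : f s != f t -> (s == t) = false.
  by move=> NE; apply/negbTE; apply: contra NE => /eqP ->.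
pose B (ds : seq T) : 'M[R]_n :=
  \matrix_(s, t) if (f s \in ds) && (f s == f t) then A s t else (s == t)%:R.
transitivity (\det (B cs)).
  congr (\det _); apply/matrixP => s t; rewrite mxE fcs /=.
  by have [//|NE] := eqVneq (f s) (f t); rewrite A0 // (fneq _ _ NE).
elim: cs ucs {fcs} => [|c cs IH] /=.
  rewrite big_nil => _; rewrite -[RHS](det1 R n); congr (\det _).
  by apply/matrixP => s t; rewrite !mxE.
case/andP=> cNcs ucs; rewrite big_cons -IH // -det_principal -det_mulmx.
congr (\det _); apply/matrixP => s t; rewrite !mxE inE.
have [fsc|fsNc] := eqVneq (f s) c; last first.
  rewrite (bigD1 s) //= big1 ?addr0 => [|k kNs]; last first.
    by rewrite mxE !inE (negbTE fsNc) [s == k]eq_sym (negbTE kNs) mul0r.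
  by rewrite !mxE !inE (negbTE fsNc) eqxx mul1r.
rewrite /= (bigD1 t) //= big1 ?addr0 => [|k kNt]; last first.
  rewrite !mxE !inE fsc eqxx /=; have [fkc|fkNc] := eqVneq (f k) c.
    by rewrite fkc (negbTE cNcs) (negbTE kNt) mulr0.
  by rewrite fneq ?mul0r // fsc eq_sym.
rewrite !mxE !inE fsc eqxx /= [c == _]eq_sym.
have [ftc|ftNc] := eqVneq (f t) c; first by rewrite ftc (negbTE cNcs) !eqxx mulr1n mulr1.
by rewrite fneq ?mul0r // fsc eq_sym.
Qed.

Section Coefficients.
Variable n : nat.

Definition mkmon (m e : nat -> nat) : 'X_{1.. n + n} :=
  [multinom match split i with inl s => m s | inr s => e s end | i < n + n].

Lemma mkmonl m e s : mkmon m e (lshift n s) = m s.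
Proof. by rewrite mnmE (unsplitK (inl s)). Qed.

Lemma mkmonr m e s : mkmon m e (rshift n s) = e s.
Proof. by rewrite mnmE (unsplitK (inr s)). Qed.

Lemma mnm_splitP (M M' : 'X_{1.. n + n}) :
  (forall s, M (lshift n s) = M' (lshift n s)) ->
  (forall s, M (rshift n s) = M' (rshift n s)) -> M = M'.
Proof.
by move=> Hl Hr; apply/mnmP => i; rewrite -[i]splitK; case: split => s /=.
Qed.

(** Each Leibniz term is a scalar times one monomial. The scalars [a] are 1 for [Delta] and the
    same-column indicators for Garnir polynomials. *)
Lemma mcoeff_det (a : 'M[rat]_n) (r c : 'I_n -> nat) M :
  (\det (\matrix_(s, t) (a s t *: (varX s ^+ r t * varY s ^+ c t))))@_M =
  \det (\matrix_(s, t) (a s t *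
    ((M (lshift n s) == r t) && (M (rshift n s) == c t))%:R)).
Proof.
rewrite /determinant raddf_sum; apply: eq_bigr => p _ /=.
rewrite !mulr_sign; transitivity
  ((-1) ^+ p * (\prod_s (a s (p s) *: (varX s ^+ r (p s) * varY s ^+ c (p s))))@_M).
  rewrite mulr_sign; case: ifP => _; rewrite ?mcoeffN; [congr (- _)|];
  by congr (_@_M); apply: eq_bigr => s _; rewrite mxE.
rewrite mulr_sign; set x := (_@_M); set y := \prod_s _.
suff -> : x = y by [].
rewrite /x /y {x y}.
have -> : \prod_s (a s (p s) *: (varX s ^+ r (p s) * varY s ^+ c (p s))) =
  (\prod_s a s (p s)) *: (\prod_s (varX s ^+ r (p s) * varY s ^+ c (p s))).
  by rewrite scaler_prod.
pose N : 'X_{1.. n + n} := [multinom match split i with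
   inl s => r (p s) | inr s => c (p s) end | i < n + n].
have -> : \prod_s (varX s ^+ r (p s) * varY s ^+ c (p s)) = 'X_[N].
  rewrite mpolyXE_id big_split_ord /= big_split; congr (_ * _);
  apply: eq_bigr => s _; rewrite mnmE.
    by rewrite (unsplitK (inl s)).
  by rewrite (unsplitK (inr s)).
rewrite mcoeffZ mcoeffX.
rewrite [RHS](eq_bigr (fun s => a s (p s) *
  ((M (lshift n s) == r (p s)) && (M (rshift n s) == c (p s)))%:R)); last first.
  by move=> s _; rewrite mxE.
rewrite big_split /=; congr (_ * _).
have [E|NE] := eqVneq N M.
  rewrite big1 // => s _; rewrite -E !mnmE (unsplitK (inl s)) (unsplitK (inr s)).
  by rewrite !eqxx.
have [H|/forallPn [s Hs]] := boolP [forall s : 'I_n,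
    (M (lshift n s) == r (p s)) && (M (rshift n s) == c (p s))].
  case/eqP: NE; apply: mnm_splitP => s; have /andP[/eqP El /eqP Er] := forallP H s.
    by rewrite El mnmE (unsplitK (inl s)).
  by rewrite Er mnmE (unsplitK (inr s)).
by rewrite (bigD1 s) //= (negbTE Hs) mul0r.
Qed.

Lemma mcoeff_Delta D M : (Delta n D)@_M =
  incid n (fun s => (nth 0 M s, nth 0 M (n + s))%N) (lex_cells D).
Proof.
have -> : Delta n D = \det (\matrix_(s, t) ((const_mx 1 : 'M[rat]_n) s t *:
    (varX s ^+ (nth (0, 0)%N (lex_cells D) t).1 *
     varY s ^+ (nth (0, 0)%N (lex_cells D) t).2))).
  by congr (\det _); apply/matrixP => s t; rewrite !mxE scale1r.
rewrite (@mcoeff_det _ (fun t => (nth (0, 0)%N (lex_cells D) t).1)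
  (fun t => (nth (0, 0)%N (lex_cells D) t).2)).
congr (\det _); apply/matrixP => s t; rewrite !mxE mul1r; congr (_%:R).
by rewrite !(mnm_nth 0%N) /=; case: (nth _ (lex_cells D) t) => r c; rewrite xpair_eqE.
Qed.

(* The divided-power normalization turns partial derivatives into shifts. *)
Definition dcoeff (q : QXY n) (M : 'X_{1.. n + n}) : rat :=
  q@_M * (\prod_i (M i)`!)%:R.

Lemma dcoeff_mderivm k q M : dcoeff (mderivm k q) M = dcoeff q (M + k)%MM.
Proof.
rewrite /dcoeff mcoeff_mderivm mulrnAl -mulrnAr addmC -mulr_natl; congr (_ * _).
rewrite -natrM -big_split; congr (_%:R); apply: eq_bigr => i _ /=.
by rewrite mnmDE -(@ffact_fact (M i + k i) (k i)) ?leq_addl // addnK.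
Qed.

Lemma dcoeffD p q M : dcoeff (p + q) M = dcoeff p M + dcoeff q M.
Proof. by rewrite /dcoeff mcoeffD mulrDl. Qed.

Lemma dcoeffZ a q M : dcoeff (a *: q) M = a * dcoeff q M.
Proof. by rewrite /dcoeff mcoeffZ mulrA. Qed.

Lemma dcoeff_sum (I : Type) (s : seq I) (P : pred I) (F : I -> QXY n) M :
  dcoeff (\sum_(x <- s | P x) F x) M = \sum_(x <- s | P x) dcoeff (F x) M.
Proof. by rewrite /dcoeff raddf_sum mulr_suml. Qed.

Lemma dcoeff_inj p q : dcoeff p =1 dcoeff q -> p = q.
Proof.
move=> E; apply/mpolyP => M; apply: (mulIf _ (E M)).
by rewrite pnatr_eq0 -lt0n prodn_gt0 // => i; rewrite fact_gt0.
Qed.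

Lemma YfreeP (q : QXY n) : Yfree q <->
  (forall (M : 'X_{1.. n + n}) (s : 'I_n), M (rshift n s) != 0%N -> dcoeff q M = 0).
Proof.
split=> [Yq M s Ms|H M Mq s].
  rewrite /dcoeff memN_msupp_eq0 ?mul0r //.
  by apply: contra Ms => /Yq ->.
apply/eqP; apply: contraLR Mq => /H; rewrite mcoeff_msupp negbK => /eqP.
rewrite mulf_eq0 => /orP[//|]; rewrite pnatr_eq0 eqn0Ngt prodn_gt0 //.
by move=> i; rewrite fact_gt0.
Qed.

Lemma Yfree_inj p q : Yfree p -> Yfree q ->
  (forall m, m n = 0%N -> dcoeff p (mkmon m (fun=> 0%N)) = dcoeff q (mkmon m (fun=> 0%N))) ->
  p = q.
Proof.
move=> /YfreeP Yp /YfreeP Yq E; apply: dcoeff_inj => M.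
have [/existsP[s Ms]|/existsPn H] := boolP [exists s : 'I_n, M (rshift n s) != 0%N].
  by rewrite (Yp _ _ Ms) (Yq _ _ Ms).
have -> : M = mkmon (fun s => if (s < n)%N then nth 0%N M s else 0%N) (fun=> 0%N).
  apply: mnm_splitP => s; rewrite ?mkmonl ?mkmonr.
    by rewrite ltn_ord (mnm_nth 0%N).
  by apply/eqP; rewrite -[_ == _]negbK H.
by apply: E; rewrite ltnn.
Qed.

End Coefficients.

(** * Standard tableaux *)

Section StandardCells.
Local Open Scope nat_scope.
Variable K : nat.
Implicit Types (nu : nat -> nat) (P : seq cell) (lam : seq (nat * nat)).

Lemma size_cells nu P : shape K nu -> uniq P ->
  (forall p, (p \in P) = (p.2 < nu p.1)) -> size P = \sum_(r < K) nu r.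
Proof.
move=> sh uP memP.
have : perm_eq P [seq (r, c) | r <- iota 0 K, c <- iota 0 (nu r)].
  apply: uniq_perm => // [|[r c]].
    apply: allpairs_uniq_dep; rewrite ?iota_uniq //; first by move=> r _; apply: iota_uniq.
    by move=> _ _ /allpairsPdep[r [c [_ _ ->]]] /allpairsPdep[r' [c' [_ _ ->]]] [-> ->].
  rewrite memP /=; apply/idP/allpairsPdep => [lt|[r' [c' [rK ct [-> ->]]]]].
    exists r, c; rewrite !mem_iota lt /=; split=> //; rewrite add0n ltnNge.
    by apply/negP => /(proj2 sh) E; rewrite E in lt.
  by move: ct; rewrite mem_iota.
move/perm_size ->; rewrite size_allpairs_dep sumnE big_map.
rewrite (eq_bigr nu); last by move=> r _; rewrite size_iota.
by rewrite -(big_mkord xpredT) /index_iota subn0.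
Qed.

Lemma count_col nu P c : shape K nu -> uniq P ->
  (forall p, (p \in P) = (p.2 < nu p.1)) ->
  count (fun p => p.2 == c) P = colh K nu c.
Proof.
move=> sh uP memP.
have : perm_eq [seq p <- P | p.2 == c] [seq (r, c) | r <- iota 0 (colh K nu c)].
  apply: uniq_perm; first exact: filter_uniq.
    by rewrite map_inj_uniq ?iota_uniq // => ? ? [].
  move=> [r c']; rewrite mem_filter memP /=.
  apply/andP/mapP => [[/eqP -> lt]|[r' + [-> ->]]].
    by exists r; rewrite // mem_iota /= ltn_colh.
  by rewrite mem_iota /= add0n ltn_colh.
by move/perm_size; rewrite size_filter size_map size_iota.
Qed.

(* A standard tableau is given by the list of the cells of its entries. *)
Definition std_cells nu P : Prop :=
  [/\ uniq P, forall p, (p \in P) = (p.2 < nu p.1),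
      forall r c c', (r, c) \in P -> (r, c') \in P -> c < c' ->
        index (r, c) P < index (r, c') P
    & forall r r' c, (r, c) \in P -> (r', c) \in P -> r < r' ->
        index (r, c) P < index (r', c) P].

(** This is the condition [m_s < alpha_T(s)]: the entries below [s] in the next column fill its rows
    0 to [r_k], so [alpha_T(s)] is [r_s + 1] minus their number. *)
Definition exp_bound P (k : nat -> nat) : Prop :=
  forall s, s < size P -> k s +
    count (fun q => q.2 == (nth (0, 0) P s).2.+1) (take s P) <= (nth (0, 0) P s).1.

Lemma exp_bound_rcons P p k : exp_bound (rcons P p) k <->
  exp_bound P k /\ k (size P) + count (fun q => q.2 == p.2.+1) P <= p.1.
Proof.
split=> [H|[H Hp] s].
  split=> [s lt_s|].
    have := H s; rewrite size_rcons ltnS nth_rcons lt_s -cats1 takel_cat //.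
      by apply; apply: ltnW.
    exact: ltnW.
  have := H (size P); rewrite size_rcons ltnSn nth_rcons ltnn eqxx.
  by rewrite -cats1 take_size_cat //; apply.
rewrite size_rcons ltnS leq_eqVlt => /orP[/eqP ->|lt_s].
  by rewrite nth_rcons ltnn eqxx -cats1 take_size_cat.
by rewrite nth_rcons lt_s -cats1 takel_cat ?H // ltnW.
Qed.

(** The equation [u = i + (a - r)] is solved by [r = i + a - u]; the bound on [u] says that this row
    is as long as row [a]. *)
Lemma labs_from_intro n nu i j a lam u : shape K nu -> nu a.+1 < nu a -> a < K ->
  i <= u <= a -> j < nu a -> u - i + colh K nu (nu a) <= a ->
  lam \in labs K n (dec nu a) ->
  rcons lam ((nu a).-1, u) \in labs_from K n nu i j.
Proof.
move=> sh lt_a aK /andP[iu ua] ja ub lamL.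
have nuE : nu (i + a - u) = nu a.
  apply/eqP; rewrite eqn_leq; apply/andP; split.
    by rewrite leqNgt -(@ltn_colh K) // -leqNgt; lia.
  by apply: (proj1 sh); lia.
have lrE : lrow K nu (i + a - u) = a.
  by rewrite -[RHS](lrow_last sh lt_a) /lrow nuE.
apply/labs_fromP; exists (i + a - u), lam; rewrite lrE nuE; split=> //; try lia.
by congr (rcons _ (_, _)); lia.
Qed.

Lemma std_cells_rcons nu a P : shape K nu -> nu a.+1 < nu a ->
  std_cells (dec nu a) P -> std_cells nu (rcons P (a, (nu a).-1)).
Proof.
move=> sh lt_a [uP memP rows cols].
have aNP : (a, (nu a).-1) \notin P by rewrite memP /dec eqxx /=; lia.
have idx p : p \in P -> index p (rcons P (a, (nu a).-1)) = index p P.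
  by move=> pP; rewrite -cats1 index_cat pP.
have idxa : index (a, (nu a).-1) (rcons P (a, (nu a).-1)) = size P.
  by rewrite -cats1 index_cat (negbTE aNP) /= eqxx addn0.
have mem p : (p \in rcons P (a, (nu a).-1)) = (p.2 < nu p.1).
  rewrite mem_rcons inE memP /dec; case: p => r c /=.
  have [->|rN] := eqVneq r a; first by rewrite xpair_eqE eqxx; lia.
  by rewrite xpair_eqE (negbTE rN) subn0.
split=> //; first by rewrite rcons_uniq aNP.
  move=> r c c' H H' lt_c; have := H'; have := H; rewrite !mem_rcons !inE.
  case/orP=> [/eqP [rE cE]|rcP]; first by move: H' lt_c; rewrite mem rE cE /=; lia.
  case/orP=> [/eqP ->|rcP']; first by rewrite idxa idx // index_mem.
  by rewrite !idx // rows.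
move=> r r' c H H' lt_r; have := H'; have := H; rewrite !mem_rcons !inE.
case/orP=> [/eqP [rE cE]|rcP].
  move: H' lt_r; rewrite mem rE cE /= => H' lt_r.
  by have := proj1 sh _ _ lt_r; lia.
case/orP=> [/eqP ->|rcP']; first by rewrite idxa idx // index_mem.
by rewrite !idx // cols.
Qed.

(** A cell to the right of [p] or above it would have to come later in the list, so [p] is a
    corner. *)
Lemma std_cells_last nu P p : shape K nu -> std_cells nu (rcons P p) ->
  [/\ nu p.1.+1 < nu p.1, p.2 = (nu p.1).-1, p.1 < K & std_cells (dec nu p.1) P].
Proof.
case: p => a c sh [uP memP rows cols] /=.
have [aNP uP'] : (a, c) \notin P /\ uniq P by move: uP; rewrite rcons_uniq => /andP.
have idx p : p \in P -> index p (rcons P (a, c)) = index p P.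
  by move=> pP; rewrite -cats1 index_cat pP.
have idxa : index (a, c) (rcons P (a, c)) = size P.
  by rewrite -cats1 index_cat (negbTE aNP) /= eqxx addn0.
have aI : (a, c) \in rcons P (a, c) by rewrite mem_rcons inE eqxx.
have lt_c : c < nu a by rewrite -[_ < _](memP (a, c)).
have le_idx p : p \in rcons P (a, c) -> index p (rcons P (a, c)) <= size P.
  by rewrite -index_mem size_rcons.
have ltN p : p \in rcons P (a, c) ->
    ~~ (index (a, c) (rcons P (a, c)) < index p (rcons P (a, c))).
  by rewrite idxa -leqNgt; apply: le_idx.
have le_c : nu a <= c.+1.
  rewrite leqNgt; apply/negP => lt; have mI : (a, c.+1) \in rcons P (a, c) by rewrite memP.
  by case/negP: (ltN _ mI); apply: rows.
have le_a : nu a.+1 <= c.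
  rewrite leqNgt; apply/negP => lt; have mI : (a.+1, c) \in rcons P (a, c) by rewrite memP.
  by case/negP: (ltN _ mI); apply: cols.
split; first by apply: leq_ltn_trans lt_c.
- lia.
- by rewrite ltnNge; apply/negP => /(proj2 sh) E; rewrite E in lt_c.
split=> //.
- move=> [r c']; have := memP (r, c'); rewrite mem_rcons inE /dec /=.
  have [E|NE] := eqVneq (r, c') (a, c).
    by case: E => -> ->; rewrite (negbTE aNP) eqxx; lia.
  move=> /= ->; have [rE|] := eqVneq r a; last by rewrite subn0.
  by move: NE; rewrite rE xpair_eqE eqxx /=; lia.
- by move=> r c1 c2 H1 H2 lt; rewrite -!idx // rows // mem_rcons inE ?H1 ?H2 orbT.
by move=> r1 r2 c1 H1 H2 lt; rewrite -!idx // cols // mem_rcons inE ?H1 ?H2 orbT.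
Qed.

Lemma mkseqS_rcons (T : Type) (f : nat -> T) n :
  mkseq f n.+1 = rcons (mkseq f n) (f n).
Proof. by rewrite /mkseq -addn1 iotaD map_cat cats1 add0n. Qed.

(** Together with [labs_std_cells], this identifies labels with pairs of a standard tableau and an
    admissible exponent; both proofs remove the largest entry. *)
Lemma std_cells_labs n nu P k : shape K nu -> \sum_(r < K) nu r = n ->
  std_cells nu P -> exp_bound P k ->
  let lam := mkseq (fun s => ((nth (0, 0) P s).2, k s)) n in
  lam \in labs K n nu /\ lcells lam = P.
Proof.
elim: n nu P => [|n IHn] nu P sh sum_nu stdP expP.
  case: (stdP) => uP memP _ _; have := size_cells sh uP memP.
  by rewrite sum_nu => /size0nil ->.
have szP : size P = n.+1 by case: (stdP) => uP memP _ _; rewrite (size_cells sh uP memP).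
case/lastP: P stdP expP szP => // P [a c] stdP /exp_bound_rcons[expP expa].
rewrite size_rcons => -[szP].
have [/= lt_a cE aK stdP'] := std_cells_last sh stdP.
have a_gt0 := leq_ltn_trans (leq0n _) lt_a.
have shd := shape_dec sh lt_a; have sumd := sum_dec aK a_gt0 sum_nu.
have [] := IHn _ P shd sumd stdP' expP.
set lam := mkseq _ n => lamL cellsE.
have -> : mkseq (fun s => ((nth (0, 0) (rcons P (a, c)) s).2, k s)) n.+1 =
    rcons lam ((nu a).-1, k n).
  rewrite mkseqS_rcons nth_rcons szP ltnn eqxx -cE; congr rcons.
  apply/eq_in_map => s; rewrite mem_iota add0n /= => lt_s.
  by rewrite nth_rcons szP lt_s.
have [_ cE'] := fills_rcons (k n) sh lt_a (labs_fills shd sumd lamL).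
split; last by rewrite cE' cellsE cE.
apply: labs_from_intro => //.
  by move: expa; rewrite szP /=; lia.
case: (stdP') => uP memP _ _.
(* The corner lies in column [nu a - 1]; removing it keeps the height of the next column, in which
   [exp_bound] counts. *)
have E : colh K nu (nu a) = colh K (dec nu a) (nu a).
  by rewrite (colh_dec _ sh lt_a) (_ : (nu a == _) = false) ?addn0 //; lia.
rewrite subn0 E -(count_col (nu a) shd uP memP).
by move: expa; rewrite szP /= cE prednK.
Qed.

Lemma labs_std_cells n nu lam : shape K nu -> \sum_(r < K) nu r = n ->
  lam \in labs K n nu -> std_cells nu (lcells lam) /\ exp_bound (lcells lam) (lexp lam).
Proof.
elim: n nu lam => [|n IHn] nu lam sh sum_nu.
  move=> lamL; have [sz _ ul mem] := labs_fills sh sum_nu lamL.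
  move: sz mem => /size0nil -> mem; split=> //.
case/labs_fromP=> r [lam1 [_ rK nur lam1L ->]].
have [le_r nua lt_a aK] := lrowP sh nur; set a := lrow K nu r in le_r nua lt_a aK lam1L *.
have a_gt0 := leq_ltn_trans (leq0n _) lt_a.
have shd := shape_dec sh lt_a; have sumd := sum_dec aK a_gt0 sum_nu.
have [stdl expl] := IHn _ _ shd sumd lam1L.
have fl := labs_fills shd sumd lam1L.
rewrite -nua; have [_ ->] := fills_rcons (0 + a - r) sh lt_a fl.
split; first exact: std_cells_rcons.
have [sz _ _ _] := fl.
apply/exp_bound_rcons; split.
  move=> s; rewrite size_lcells => lt_s; have := expl s; rewrite size_lcells.
  by rewrite /lexp nth_rcons lt_s; apply.
rewrite /lexp nth_rcons size_lcells ltnn eqxx /= prednK //.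
have [ul memP _ _] := stdl; rewrite (count_col _ shd ul memP).
have E : colh K nu (nu a) = colh K (dec nu a) (nu a).
  by rewrite (colh_dec _ sh lt_a) (_ : (nu a == _) = false) ?addn0 //; lia.
rewrite -E add0n; have : ~~ (r < colh K nu (nu a)) by rewrite ltn_colh // nua ltnn.
by rewrite -leqNgt; lia.
Qed.

End StandardCells.

(** * Tableaux as lists of cells, and the numbers alpha *)

Section Tableaux.
Local Open Scope nat_scope.
Implicit Types (D : {fset cell}) (T : cell -> nat).

Lemma mem_diagram mu p : (p \in diagram mu) = (p.2 < nth 0 mu p.1).
Proof.
rewrite in_fset_/=; case: p => r c /=; apply/allpairsPdep/idP => [[r' [c' [rI cI [-> ->]]]]|lt].
  by move: cI; rewrite mem_iota.
exists r, c; rewrite !mem_iota lt /=; split=> //; rewrite add0n ltnNge.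
by apply/negP => le; rewrite nth_default in lt.
Qed.

Lemma position_eq D T p : {in D &, injective T} -> p \in D ->
  position D T (T p) = p.
Proof.
move=> Tinj pD; rewrite /position; case: pickP => [q /eqP E|/(_ [` pD]%fset)].
  by apply: Tinj => //; apply: valP.
by rewrite /= eqxx.
Qed.

Lemma tableau_onto n D T : is_tableau n D T -> size (enum_fset D) = n ->
  forall s, s < n -> position D T s \in D /\ T (position D T s) = s.
Proof.
move=> [Tn Tinj] szD s lt_s.
have uT : uniq [seq T p | p <- enum_fset D].
  by rewrite map_inj_in_uniq ?fset_uniq.
have sub : {subset [seq T p | p <- enum_fset D] <= iota 0 n}.
  by move=> _ /mapP[p pD ->]; rewrite mem_iota Tn.
have [|_ E] := uniq_min_size uT sub; first by rewrite size_iota size_map szD.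
have : s \in [seq T p | p <- enum_fset D] by rewrite E mem_iota.
by case/mapP => p pD ->; rewrite position_eq.
Qed.

Definition tab_cells n D T : seq cell := mkseq (position D T) n.

Variables (K : nat).

Lemma size_fset_cells nu D : shape K nu ->
  (forall p, (p \in D) = (p.2 < nu p.1)) ->
  size (enum_fset D) = \sum_(r < K) nu r.
Proof. by move=> sh memD; apply: size_cells => //; apply: fset_uniq. Qed.

Lemma std_tab_cells n nu D T : shape K nu -> \sum_(r < K) nu r = n ->
  (forall p, (p \in D) = (p.2 < nu p.1)) -> is_standard n D T ->
  std_cells nu (tab_cells n D T) /\
  forall p, p \in D -> index p (tab_cells n D T) = T p.
Proof.
move=> sh sum_nu memD [tabT rows cols].
have szD : size (enum_fset D) = n by rewrite (size_fset_cells sh memD).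
have onto := tableau_onto tabT szD; have [Tn Tinj] := tabT.
have uP : uniq (tab_cells n D T).
  by apply/mkseq_uniqP => s s' ss ss' E; rewrite -(proj2 (onto _ ss)) E (proj2 (onto _ ss')).
have idx p : p \in D -> index p (tab_cells n D T) = T p.
  move=> pD; rewrite -{1}(position_eq Tinj pD) -(nth_mkseq (0, 0) (position D T) (Tn _ pD)).
  by rewrite index_uniq ?size_mkseq ?Tn.
have memP p : (p \in tab_cells n D T) = (p.2 < nu p.1).
  rewrite -memD; apply/mapP/idP => [[s + ->]|pD].
    by rewrite mem_iota => /andP[_ /onto []].
  by exists (T p); rewrite ?position_eq // mem_iota Tn.
split=> //; split=> // [r c c'|r r' c]; rewrite !memP -!memD => H1 H2 lt; rewrite !idx //.
  exact: rows.
exact: cols.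
Qed.

Lemma std_cells_tab n nu D P : size P = n -> std_cells nu P ->
  (forall p, (p \in D) = (p.2 < nu p.1)) ->
  is_standard n D (index ^~ P) /\ tab_cells n D (index ^~ P) = P.
Proof.
move=> szP [uP memP rows cols] memD.
have mDP p : (p \in D) = (p \in P) by rewrite memD memP.
have tab : is_tableau n D (index ^~ P).
  split=> [p|p q]; rewrite !mDP -?szP ?index_mem // => pP qP E.
  by rewrite -[p](nth_index (0, 0) pP) E nth_index.
split.
  by split=> // [r c c'|r r' c]; rewrite !mDP; [apply: rows|apply: cols].
apply: (@eq_from_nth _ (0, 0)); rewrite size_mkseq // => s lt_s.
rewrite nth_mkseq //; have sP : s < size P by rewrite szP.
rewrite -{1}(index_uniq (0, 0) sP uP).
by rewrite (@position_eq D (index ^~ P)) ?mDP ?mem_nth //; case: tab.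
Qed.

Lemma bigmax_mem (s : seq nat) : ~~ nilp s -> \max_(k <- s) k \in s.
Proof.
elim: s => // x s IHs _; rewrite big_cons; case: s IHs => [|y s] IHs.
  by rewrite big_nil maxn0 mem_head.
rewrite /maxn; case: ifP => _; last exact: mem_head.
by rewrite inE IHs ?orbT.
Qed.

(** Columns increase, so the entries below [s] in the next column occupy an initial segment of rows,
    whose top holds the largest of them; their number is one more than its row. *)
Lemma alpha_std n nu D T s : shape K nu -> \sum_(r < K) nu r = n ->
  (forall p, (p \in D) = (p.2 < nu p.1)) -> is_standard n D T -> s < n ->
  alpha D T s = (position D T s).1.+1 -
    count (fun q => q.2 == (position D T s).2.+1) (take s (tab_cells n D T)).
Proof.
move=> sh sum_nu memD stdT lt_s.
have [[uP memP rowsP colsP] idx] := std_tab_cells sh sum_nu memD stdT.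
have [[Tn Tinj] rows cols] := stdT.
rewrite /alpha; set p := position D T s; set c := p.2.+1.
set Kf := [seq q <- enum_fset D | (q.2 == c) && (T q < s)].
have memKf q : (q \in Kf) = [&& q \in D, q.2 == c & T q < s].
  by rewrite mem_filter andbC.
have -> : count (fun q => q.2 == c) (take s (tab_cells n D T)) = size Kf.
  rewrite -size_filter; apply/perm_size/uniq_perm.
  - by rewrite filter_uniq ?take_uniq.
  - by rewrite filter_uniq ?fset_uniq.
  move=> q; rewrite memKf mem_filter memD -memP.
  have [qP|qNP] := boolP (q \in tab_cells n D T); last first.
    rewrite [q \in take _ _](_ : _ = false) ?andbF //.
    by apply: contraNF qNP => /mem_take.
  by rewrite in_take // idx // memD -memP.
rewrite -[size Kf](size_map T).
have [K0|KN0] := boolP (nilp [seq T q | q <- Kf]).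
  by rewrite (nilP K0) subn0.
have /mapP[[rm c'] qK maxE] := bigmax_mem KN0.
rewrite maxE; move: (qK); rewrite memKf => /and3P[qD /= /eqP c'E lt_q].
rewrite /height position_eq // size_map /=.
suff -> : size Kf = rm.+1 by rewrite subSS.
have : perm_eq Kf [seq (r, c) | r <- iota 0 rm.+1].
  apply: uniq_perm; first by rewrite filter_uniq ?fset_uniq.
    by rewrite map_inj_uniq ?iota_uniq // => ? ? [].
  move=> [r c1]; rewrite memKf.
  apply/and3P/mapP => [[rD /eqP c1E lt_r]|[r' r'I [-> ->]]].
    rewrite /= in c1E; rewrite c1E in rD lt_r *; exists r; last by [].
    rewrite mem_iota leq0n add0n ltnS andTb leqNgt; apply/negP => lt_rm.
    have : T (r, c) <= \max_(k <- [seq T q | q <- Kf]) k.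
      apply: (@leq_bigmax_seq _ _ xpredT id) => //.
      by apply: map_f; rewrite memKf rD eqxx lt_r.
    have rD' : (r, c') \in D by rewrite c'E.
    by rewrite maxE -c'E => /(leq_trans (cols _ _ _ qD rD' lt_rm)); rewrite ltnn.
  move: r'I; rewrite mem_iota /= add0n ltnS => le_r'.
  have r'D : (r', c) \in D.
    by move: qD; rewrite !memD /= c'E => H; apply: leq_trans H (proj1 sh _ _ le_r').
  split=> //; move: le_r'; rewrite leq_eqVlt -c'E => /orP[/eqP -> //|lt_r'].
  by apply: ltn_trans lt_q; apply: cols; rewrite // c'E.
by move/perm_size ->; rewrite size_map size_iota.
Qed.

End Tableaux.

(** * Garnir polynomials as single determinants *)

Section GarnirPolynomials.
Variable n : nat.

Definition gdet (l : seq cell) : QXY n :=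
  \det (\matrix_(s < n, t < n)
    (((nth (0, 0)%N l s).2 == (nth (0, 0)%N l t).2)%:R *:
      varX s ^+ (nth (0, 0)%N l t).1)).

(* The single matrix below is block diagonal, one block per column of T. *)
Lemma Garnir_gdet D T : is_tableau n D T -> size (enum_fset D) = n ->
  Garnir n D T = gdet (tab_cells n D T).
Proof.
move=> tabT szD; have onto := tableau_onto tabT szD; have [Tn Tinj] := tabT.
rewrite /gdet (@det_blocks _ _ _ (fun s : 'I_n => (position D T s).2) _
  (enum_fset [fset p.2 | p in D]%fset)).
- apply: eq_bigr => c _ /=.
  have -> : [set s | (position D T (nat_of_ord s)).2 == c] = col_entries n D T c.
    apply/setP => s; rewrite !inE; apply/eqP/existsP => [<-|[p /andP[/eqP <- /eqP <-]]].
      have [pD TE] := onto _ (ltn_ord s).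
      by exists [` pD]%fset; rewrite /= TE !eqxx.
    by rewrite position_eq //; apply: valP.
  congr (\det _); apply/matrixP => s t; rewrite !mxE !nth_mkseq ?ltn_ord //.
  have col_of (x : 'I_#|col_entries n D T c|) :
      (position D T (enum_val x : 'I_n)).2 = c.
    have := enum_valP x; rewrite !inE => /existsP[p /andP[/eqP pc /eqP <-]].
    by rewrite position_eq //; apply: valP.
  by rewrite !col_of eqxx scale1r.
- exact: fset_uniq.
- by move=> s; apply: in_imfset; case: (onto _ (ltn_ord s)).
by move=> s t /negbTE NE; rewrite mxE !nth_mkseq ?ltn_ord // NE scale0r.
Qed.

Lemma mcoeff_gdet l (M : 'X_{1.. n + n}) : (gdet l)@_M =
  if [forall s, M (rshift n s) == 0%N] then
    incid n (fun s => (nth 0 M s, (nth (0, 0) l s).2)%N) l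
  else 0.
Proof.
have -> : gdet l = \det (\matrix_(s, t)
    ((\matrix_(s < n, t < n) ((nth (0, 0)%N l s).2 == (nth (0, 0)%N l t).2)%:R) s t *:
    (varX s ^+ (nth (0, 0)%N l t).1 * varY s ^+ 0))).
  by congr (\det _); apply/matrixP => s t; rewrite !mxE expr0 mulr1.
rewrite (@mcoeff_det _ _ (fun t => (nth (0, 0)%N l t).1) (fun=> 0%N)).
case: forallP => [H|/forallP /forallPn[s Hs]]; last first.
  by apply: (@det0_row _ _ _ s) => t; rewrite !mxE (negbTE Hs) andbF mulr0.
congr (\det _); apply/matrixP => s t; rewrite !mxE H andbT -natrM mulnb.
congr (_%:R); rewrite (mnm_nth 0%N) /=; case: (nth _ l t) => r c /=.
by rewrite xpair_eqE andbC.
Qed.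

(** Either the determinant vanishes or [z] rearranges [l]. Hence the factorials in [dcoeff] amount
    to a constant independent of the exponent. *)
Lemma incid_weight N z l (g : cell -> nat) : size l = N ->
  incid N z l * (\prod_(s < N) g (z s))%:R = incid N z l * (\prod_(p <- l) g p)%:R.
Proof.
move=> szl; have [->|/incid_neq0[p Hp]] := eqVneq (incid N z l) 0.
  by rewrite !mul0r.
congr (_ * _%:R); rewrite (big_nth (0, 0)%N) szl big_mkord [RHS](reindex_perm p).
by apply: eq_bigr => s _; rewrite Hp.
Qed.

Lemma dcoeff_gdet l m : size l = n ->
  dcoeff (gdet l) (mkmon n m (fun=> 0%N)) =
  (\prod_(p <- l) (p.1)`!)%:R * incid n (fun s => (m s, (nth (0, 0) l s).2)%N) l.
Proof.
move=> szl; rewrite /dcoeff mcoeff_gdet.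
have -> : [forall s, mkmon n m (fun=> 0%N) (rshift n s) == 0%N].
  by apply/forallP => s; rewrite mkmonr.
rewrite (@eq_incid _ _ (fun s => (m s, (nth (0, 0) l s).2)%N)); last first.
  move=> s lt_s; rewrite -(mkmonl m (fun=> 0%N) (Ordinal lt_s)).
  by rewrite (mnm_nth 0%N).
rewrite big_split_ord /= [X in (_ * X)%N]big1 => [|s _]; last by rewrite mkmonr.
rewrite muln1 [RHS]mulrC -(incid_weight _ (fun p => (p.1)`!) szl) /=.
by congr (_ * _%:R); apply: eq_bigr => s _; rewrite mkmonl.
Qed.

Lemma dcoeff_Delta D m e : size (lex_cells D) = n ->
  dcoeff (Delta n D) (mkmon n m e) =
  (\prod_(p <- lex_cells D) ((p.1)`! * (p.2)`!))%:R *
  incid n (fun s => (m s, e s)) (lex_cells D).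
Proof.
move=> szl; rewrite /dcoeff mcoeff_Delta.
rewrite (@eq_incid _ _ (fun s => (m s, e s))); last first.
  move=> s lt_s; rewrite -(mkmonl m e (Ordinal lt_s)) -(mkmonr m e (Ordinal lt_s)).
  by rewrite !(mnm_nth 0%N).
rewrite [RHS]mulrC -(incid_weight _ (fun p => (p.1)`! * (p.2)`!)%N szl) /=.
rewrite big_split_ord big_split /=.
by congr (_ * (_ * _)%:R); apply: eq_bigr => s _; rewrite ?mkmonl ?mkmonr.
Qed.

End GarnirPolynomials.

(** * The polynomials of the labels *)

(* The position of an entry after [shift_up u b], from its position before. *)
Definition lift_cell u b (p : cell) : cell := (p.1 + ((p.2 == b) && (u <= p.1)), p.2)%N.

Section Lifting.
Variable K : nat.
Implicit Type nu : nat -> nat.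

Lemma lift_cell_inj u b : injective (lift_cell u b).
Proof.
move=> [r c] [r' c'] [/= + E]; rewrite -{}E; move: (c == b) => e H.
by congr (_, _); move: H; case: e => /=; lia.
Qed.

Lemma lift_cell_neq u b p : lift_cell u b p != (u, b).
Proof.
by case: p => r c; apply/eqP => -[/= + E]; rewrite E eqxx /=; lia.
Qed.

Lemma lift_cell_mem nu a u p : shape K nu -> (nu a.+1 < nu a)%N ->
  (p.2 < dec nu a p.1)%N ->
  ((lift_cell u (nu a).-1 p).2 < nu (lift_cell u (nu a).-1 p).1)%N.
Proof.
case: p => r c sh lt_a; rewrite /lift_cell /dec /=; have [mono _] := sh.
have [->|_] /= := eqVneq c (nu a).-1; last by rewrite addn0; lia.
have [_|_] := leqP u r; last by rewrite addn0; lia.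
rewrite addn1; have [->|rN] := eqVneq r a; first by lia.
move=> lt; have : (r <= a)%N by rewrite leqNgt; apply/negP => /mono; lia.
rewrite leq_eqVlt (negbTE rN) /= => /mono; lia.
Qed.

(** In the column of the corner, rows [u] to [a - 1] move up to [u + 1] to [a], and [(u, b)] fills
    the gap. *)
Lemma perm_lift_cells nu a u P : shape K nu -> (nu a.+1 < nu a)%N ->
  uniq P -> (forall p, (p \in P) = (p.2 < dec nu a p.1)%N) -> (u <= a)%N ->
  uniq (rcons (map (lift_cell u (nu a).-1) P) (u, (nu a).-1)) /\
  perm_eq (rcons (map (lift_cell u (nu a).-1) P) (u, (nu a).-1))
          (rcons P (a, (nu a).-1)).
Proof.
move=> sh lt_a uP memP ua; set l := rcons _ _; set l' := rcons _ _.
have ul : uniq l.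
  rewrite rcons_uniq map_inj_uniq ?uP ?andbT; last exact: lift_cell_inj.
  by apply/mapP => -[p _ E]; case/eqP: (lift_cell_neq u (nu a).-1 p).
have ul' : uniq l' by rewrite rcons_uniq uP memP /dec eqxx /=; lia.
have meml' p : (p.2 < nu p.1)%N -> p \in l'.
  rewrite mem_rcons inE memP /dec; case: p => r c /=.
  have [->|_] := eqVneq r a; last by rewrite subn0 => ->; rewrite orbT.
  by rewrite xpair_eqE eqxx; lia.
have sub : {subset l <= l'}.
  move=> p; rewrite mem_rcons inE => /orP[/eqP ->|/mapP[q qP ->]]; apply: meml'.
    by have := proj1 sh _ _ ua; rewrite /=; lia.
  by apply: lift_cell_mem; rewrite // -memP.
have [|_ E] := uniq_min_size ul sub; first by rewrite !size_rcons size_map.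
by split=> //; apply: uniq_perm.
Qed.

End Lifting.

Lemma seq_choice (T : eqType) (U : Type) (u0 : U) (L : seq T) (R : T -> U -> Prop) :
  (forall x, x \in L -> exists u, R x u) ->
  exists f, forall x, x \in L -> R x (f x).
Proof.
elim: L => [|x L IH] H; first by exists (fun=> u0).
have [|f Hf] := IH; first by move=> y yL; apply: H; rewrite inE yL orbT.
have [u Hu] := H x (mem_head _ _); exists (fun y => if y == x then u else f y) => y.
by rewrite inE; case: eqP => [-> //|_] /=; apply: Hf.
Qed.

Section LabelPolynomials.
Variables K n : nat.
Implicit Type nu : nat -> nat.

(** The first [n] items give the tableau and the exponents, the item of index [n] gives the hole
    [(u, b)]. *)
Definition labpoly (lam : seq (nat * nat)) : QXY n :=
  mderivm (mkmon n (lexp lam) (fun=> 0%N))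
    (gdet n (map (lift_cell (lexp lam n) (lcol lam n)) (lcells (take n lam)))).

Lemma mkmonD m e m' e' : (mkmon n m e + mkmon n m' e')%MM =
  mkmon n (fun s => m s + m' s)%N (fun s => e s + e' s)%N.
Proof. by apply: mnm_splitP => s; rewrite mnmDE ?mkmonl ?mkmonr. Qed.

Lemma Yfree_labpoly lam : Yfree (labpoly lam).
Proof.
apply/YfreeP => M s Ms; rewrite dcoeff_mderivm /dcoeff mcoeff_gdet.
case: forallP => [/(_ s)|]; last by rewrite mul0r.
by rewrite mnmDE mkmonr addn0 (negbTE Ms).
Qed.

(** The hole is restored as an extra row, after which the lifted cells are a reordering of the cells
    of the label; [C] collects the sign and the factorials. *)
Lemma dcoeff_labpoly nu i j lam : shape K nu -> (\sum_(r < K) nu r = n.+1)%N ->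
  lam \in labs_from K n nu i j ->
  exists2 C : rat, C != 0 & forall m, m n = 0%N ->
    dcoeff (labpoly lam) (mkmon n m (fun=> 0%N)) = C * lcoef lam m.
Proof.
move=> sh sum_nu /labs_fromP[r [lam1 [ir rK jr lamL ->]]].
have [le_r nua lt_a aK] := lrowP sh (leq_ltn_trans (leq0n j) jr).
have a_gt0 := leq_ltn_trans (leq0n _) lt_a.
set a := lrow K nu r in le_r nua lt_a aK a_gt0 lamL *.
have fl := labs_fills (shape_dec sh lt_a) (sum_dec aK a_gt0 sum_nu) lamL.
have [sz _ ul meml] := fl.
rewrite -nua; set u := (i + a - r)%N; set b := (nu a).-1.
have ua : (u <= a)%N by rewrite /u; lia.
have [ul' perm_l'] := perm_lift_cells sh lt_a ul meml ua.
set l' := map _ _ in ul' perm_l'.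
have szl' : size l' = n by rewrite size_map size_lcells.
have [sg Hsg] := incid_perm (n := n.+1) (etrans (size_rcons _ _) (congr1 S szl')) perm_l'.
have [_ cE] := fills_rcons u sh lt_a fl.
exists ((\prod_(p <- l') (p.1)`!)%:R * (-1) ^+ sg).
  rewrite mulf_neq0 ?signr_eq0 // pnatr_eq0 -lt0n.
  by rewrite prodn_gt0 // => p; rewrite fact_gt0.
move=> m mn; rewrite dcoeff_mderivm mkmonD.
have -> : map (lift_cell (lexp (rcons lam1 (b, u)) n) (lcol (rcons lam1 (b, u)) n))
    (lcells (take n (rcons lam1 (b, u)))) = l'.
  by rewrite /lexp /lcol nth_rcons sz ltnn eqxx -cats1 take_size_cat.
rewrite (dcoeff_gdet _ szl') -mulrA; congr (_ * _).
rewrite lcoef_rcons sz cE -Hsg incid_rcons ?ltnn ?mn //.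
apply: eq_incid => s lt_s; rewrite lt_s /lexp nth_rcons sz lt_s.
rewrite (nth_map (0, 0)%N) ?size_lcells ?sz //= (nth_mkseq (0, 0)%N) ?sz //.
Qed.

End LabelPolynomials.

Section Span.
Variable V : lmodType rat.
Implicit Type S : V -> Prop.

Lemma span_comb S (I : Type) (s : seq I) (P : pred I) (c : I -> rat) (f : I -> V) :
  (forall x, P x -> S (f x)) -> span S (\sum_(x <- s | P x) c x *: f x).
Proof.
move=> HS; exists [seq (c x, f x) | x <- [seq x <- s | P x]]; last by rewrite big_map big_filter.
elim: s => //= x s IH; case: ifP => //= Px y; rewrite inE => /orP[/eqP ->|]; last exact: IH.
exact: HS.
Qed.

Lemma span_scale S c v : span S v -> span S (c *: v).
Proof.
case=> s HS ->; exists [seq (c * x.1, x.2) | x <- s].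
  by move=> _ /mapP[x xs ->]; exact: (HS x xs).
by rewrite big_map scaler_sumr; apply: eq_bigr => x _; rewrite scalerA.
Qed.

Lemma span_sum S (I : eqType) (s : seq I) (f : I -> V) :
  (forall x, x \in s -> span S (f x)) -> span S (\sum_(x <- s) f x).
Proof.
elim: s => [|x s IH] H; first by exists [::]; rewrite ?big_nil.
have [s1 H1 E1] := H x (mem_head _ _).
have [|s2 H2 E2] := IH; first by move=> y ys; apply: H; rewrite inE ys orbT.
exists (s1 ++ s2); last by rewrite big_cons big_cat E1 E2.
by move=> y; rewrite mem_cat => /orP[/H1|/H2].
Qed.

End Span.

(** * Label polynomials and the space of derivatives *)

Section Membership.
Variables K n : nat.
Variables (nu : nat -> nat) (D : {fset cell}) (i j : nat).
Hypotheses (sh : shape K nu) (sum_nu : (\sum_(r < K) nu r = n.+1)%N).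
Hypothesis memD : forall p, (p \in D) = (p.2 < nu p.1)%N.
Hypothesis ijD : (i, j) \in D.

Let l0 := lex_cells (D `\ (i, j))%fset.
Let l := rcons l0 (i, j).

Lemma lex_cells_rcons : [/\ uniq l, forall p, (p \in l) = (p.2 < nu p.1)%N,
  size l0 = n & size l = n.+1].
Proof.
have ul0 : uniq l0 by rewrite sort_uniq fset_uniq.
have meml0 p : (p \in l0) = (p != (i, j)) && (p \in D) by rewrite mem_sort in_fsetD1.
have ul : uniq l by rewrite rcons_uniq ul0 meml0 eqxx.
have meml p : (p \in l) = (p.2 < nu p.1)%N.
  rewrite mem_rcons inE meml0 -memD; case: eqP => [->|] //=.
have szl : size l = n.+1 by rewrite (size_cells sh ul meml).
by split=> //; move: szl; rewrite size_rcons => -[].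
Qed.

Let weight := (\prod_(p <- l0) ((p.1)`! * (p.2)`!))%:R : rat.

Let weight_neq0 : weight != 0.
Proof.
by rewrite pnatr_eq0 -lt0n prodn_gt0 // => p; rewrite muln_gt0 !fact_gt0.
Qed.

(** For [x = (i, j)] these are, up to [weight], the coefficients of [Delta]; another cell [x] plays
    the part of a hole moved there. *)
Let Dcoef x (z : nat -> cell) := incid n.+1 (fun s => if (s < n)%N then z s else x) l.

Lemma dcoeff_Delta_hole m e :
  dcoeff (Delta n (D `\ (i, j))%fset) (mkmon n m e) =
  weight * Dcoef (i, j) (fun s => (m s, e s)).
Proof.
have [ul _ szl0 _] := lex_cells_rcons.
rewrite dcoeff_Delta // /Dcoef incid_rcons ?ltnn //; congr (_ * _).
by apply: eq_incid => s ->.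
Qed.

(* The operator sum_s (d/dx_s)^h (d/dy_s)^k moves each cell of the diagram down
   by h and left by k; only moving a cell into the hole (i, j) survives. *)
Lemma move_hole h k : (0 < h + k)%N -> forall m e,
  dcoeff (\sum_(s < n) mderivm (mkmon n (fun t => h * (t == s)) (fun t => k * (t == s)))%N
    (Delta n (D `\ (i, j))%fset)) (mkmon n m e) =
  - weight * Dcoef (i + h, j + k)%N (fun s => (m s, e s)).
Proof.
move=> hk m e; have [ul meml _ szl] := lex_cells_rcons.
have dl p : shiftc h k p \in l -> p \in l.
  case: p => r c; rewrite !meml /= => lt.
  have := proj1 sh _ _ (leq_addr h r); lia.
have := incid_move (fun s => if (s < n)%N then (m s, e s) else (i, j)) hk szl ul dl.
rewrite big_ord_recr /= => E.
rewrite dcoeff_sum mulNr -mulrN; transitivity (weight * \sum_(s < n)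
  incid n.+1 (fun s' => if s' == s then
    shiftc h k (if (s' < n)%N then (m s', e s') else (i, j)) else
    if (s' < n)%N then (m s', e s') else (i, j)) l).
  rewrite mulr_sumr; apply: eq_bigr => s _.
  rewrite dcoeff_mderivm mkmonD dcoeff_Delta_hole; congr (_ * _).
  apply: eq_incid => s' _; case: eqP => [->|_].
    by rewrite ltn_ord /shiftc /= !muln1.
  by rewrite !muln0 !addn0.
congr (_ * _); apply/eqP; rewrite -addr_eq0 addrC; apply/eqP; rewrite -[RHS]E addrC.
congr (_ + _); apply: eq_incid => s; rewrite ltnS => le_s.
by case: eqP => [->|/eqP NE]; rewrite ?ltnn // ltn_neqAle NE le_s.
Qed.

(** The hole is moved from [(i, j)] to [(u, b)]; then the Y-derivatives of orders [lcol lam] pin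
    each entry to its column, and the X-derivatives of orders [lexp lam] finish. *)
Lemma labpoly_in_space_M lam : lam \in labs_from K n nu i j ->
  space_M (D `\ (i, j))%fset (labpoly n lam).
Proof.
move=> lamL; have [C CN0 HC] := dcoeff_labpoly sh sum_nu lamL.
have [ul meml szl0 szl] := lex_cells_rcons.
have [szlam _ ulam memlam] := labs_from_fills sh sum_nu lamL.
case/labs_fromP: (lamL) => r [lam1 [ir rK jr lam1L lamE]].
have [le_r nua lt_a aK] := lrowP sh (leq_ltn_trans (leq0n j) jr).
set a := lrow K nu r in le_r nua lt_a aK lam1L lamE.
set u := (i + a - r)%N in lamE; set b := (nu r).-1 in lamE.
have iu : (i <= u)%N by rewrite /u; lia.
have jb : (j <= b)%N by rewrite /b; lia.
have sz1 : size lam1 = n by move: szlam; rewrite lamE size_rcons => -[].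
pose Del := Delta n (D `\ (i, j))%fset.
have [q [C' C'N0 [Sq Hq]]] : exists q, exists2 C' : rat, C' != 0 &
    space_M (D `\ (i, j))%fset q /\ forall m e, dcoeff q (mkmon n m e) =
      C' * Dcoef (u, b) (fun s => (m s + lexp lam s, e s + lcol lam s)%N).
  pose k0 := mkmon n (lexp lam) (lcol lam).
  (* [move_hole] requires a nonzero displacement; otherwise the hole is already in place. *)
  have [uv0|uv_gt0] := posnP (u - i + (b - j)).
    exists (mderivm k0 Del), weight => //; split=> [|m e].
      have -> : mderivm k0 Del = \sum_(x <- [:: tt]) 1 *: mderivm k0 Del.
        by rewrite big_seq1 scale1r.
      by apply: span_comb => _ _; exists k0.
    rewrite dcoeff_mderivm mkmonD dcoeff_Delta_hole.
    by rewrite (_ : (i, j) = (u, b)) //; congr (_, _); lia.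
  pose ks (s : 'I_n) := mkmon n (fun t => (u - i) * (t == s))%N (fun t => (b - j) * (t == s))%N.
  exists (mderivm k0 (\sum_(s < n) mderivm (ks s) Del)), (- weight).
    by rewrite oppr_eq0.
  split=> [|m e].
    have -> : mderivm k0 (\sum_(s < n) mderivm (ks s) Del) =
        \sum_(s < n) 1 *: mderivm (ks s + k0)%MM Del.
      by rewrite raddf_sum; apply: eq_bigr => s _; rewrite scale1r mderivmDm.
    by apply: span_comb => s _; exists (ks s + k0)%MM.
  rewrite dcoeff_mderivm mkmonD move_hole // !subnKC //.
have [sg Hsg] := incid_perm (l' := lcells lam) szl (uniq_perm ul ulam
  (fun p => etrans (meml p) (esym (memlam p)))).
have Dlam m e : Dcoef (u, b) (fun s => (m s + lexp lam s, e s + lcol lam s)%N) =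
    (-1) ^+ sg * incid n.+1 (fun s => if (s < n)%N then
      (m s + lexp lam s, e s + lcol lam s)%N else (u, b)) (lcells lam).
  exact: Hsg.
have Yq : Yfree q.
  apply/YfreeP => M s Ms.
  have -> : M = mkmon n (nth 0 M) (fun t => nth 0 M (n + t))%N.
    by apply: mnm_splitP => t; rewrite ?mkmonl ?mkmonr (mnm_nth 0%N).
  rewrite Hq Dlam; set I := incid _ _ _; have [->|/incid_neq0[p Hp]] := eqVneq I 0.
    by rewrite !mulr0.
  pose cl t := (nth (0, 0)%N (lcells lam) t).2.
  (* The prescribed columns already account for the total of the column indices, so every exponent
     of Y is 0. *)
  have : (\sum_(t < n.+1) cl (p t) = \sum_(t < n.+1) cl t)%N by rewrite [RHS](reindex_perm p).
  rewrite (eq_bigr (fun t : 'I_n.+1 => if (t < n)%N then (nth 0 M (n + t) + lcol lam t) else b)%N);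
    last by move=> t _; rewrite /cl -Hp; case: ifP.
  rewrite !big_ord_recr /= ltnn.
  have -> : cl n = b.
    by rewrite /cl nth_mkseq ?szlam // /lcell /= /lcol lamE nth_rcons sz1 ltnn eqxx.
  move/addIn; rewrite (eq_bigr (fun t : 'I_n => nth 0 M (n + t) + lcol lam t)%N); last first.
    by move=> t _; rewrite ltn_ord.
  rewrite big_split /= [in RHS](eq_bigr (fun t : 'I_n => lcol lam t)); last first.
    by move=> t _; rewrite /cl nth_mkseq ?szlam ?ltnS 1?ltnW.
  move/eqP; rewrite -[X in _ == X]add0n eqn_add2r sum_nat_eq0.
  move=> /forallP/(_ s)/eqP /= E.
  by move: Ms; rewrite (mnm_nth 0%N) /= E eqxx.
have -> : labpoly n lam = (C / (C' * (-1) ^+ sg)) *: q.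
  apply: Yfree_inj => [||m mn].
  - exact: Yfree_labpoly.
  - apply/YfreeP => M s Ms; move/YfreeP: Yq => Yq.
    by rewrite dcoeffZ (Yq _ _ Ms) mulr0.
  rewrite dcoeffZ Hq Dlam HC //.
  have -> : incid n.+1 (fun s => if (s < n)%N then
      (m s + lexp lam s, 0 + lcol lam s)%N else (u, b)) (lcells lam) = lcoef lam m.
    rewrite [in RHS]lamE lcoef_rcons sz1 -lamE; apply: eq_incid => s _.
    rewrite mn; case: ifP => // lt_s.
    by rewrite lamE /lexp /lcol nth_rcons sz1 lt_s.
  by rewrite [C' * (_ * _)]mulrA mulrA divfK // mulf_neq0 ?signr_eq0.
exact: span_scale.
Qed.

(** [q] is determined by its Y-free coefficients, and those of any derivative of [Delta] are
    combinations of the [lcoef]. *)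
Lemma space_M_span q : space_M0 (D `\ (i, j))%fset q ->
  span (fun p => exists2 lam, lam \in labs_from K n nu i j & p = labpoly n lam) q.
Proof.
case=> -[s Hs qE] Yq; have [ul meml szl0 szl] := lex_cells_rcons.
(* The derivatives composing [q] need not be Y-free themselves; only their coefficients at Y-degree
   0 are compared. *)
have [a Ha] : exists a : seq (nat * nat) -> rat, forall m, m n = 0%N ->
    dcoeff q (mkmon n m (fun=> 0%N)) =
    \sum_(lam <- labs_from K n nu i j) a lam * lcoef lam m.
  rewrite {Yq}qE; elim: s Hs => [|x s IH] Hs.
    exists (fun=> 0) => m _; rewrite big_nil /dcoeff mcoeff0 mul0r big1 // => lam _.
    by rewrite mul0r.
  have [|a Ha] := IH; first by move=> y ys; apply: Hs; rewrite inE ys orbT.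
  have [k xE] := Hs x (mem_head _ _).
  have [a' Ha'] := labs_from_span i j (fun t => nth 0 k (n + t))%N (nth 0%N k) sh sum_nu szl ul meml.
  exists (fun lam => x.1 * weight * a' lam + a lam) => m mn.
  rewrite big_cons dcoeffD dcoeffZ Ha // xE dcoeff_mderivm.
  have -> : k = mkmon n (nth 0%N k) (fun t => nth 0 k (n + t))%N.
    by apply: mnm_splitP => t; rewrite ?mkmonl ?mkmonr (mnm_nth 0%N).
  rewrite mkmonD dcoeff_Delta_hole /Dcoef.
  under [RHS]eq_bigr do rewrite mulrDl.
  rewrite big_split /=; congr (_ + _).
  rewrite -[in LHS]/(weight * _) mulrA.
  rewrite (Ha' m mn) mulr_sumr; apply: eq_bigr => lam _; rewrite !mulrA //.
have [C HC] : exists C : seq (nat * nat) -> rat, forall lam,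
    lam \in labs_from K n nu i j -> C lam != 0 /\ forall m, m n = 0%N ->
      dcoeff (labpoly n lam) (mkmon n m (fun=> 0%N)) = C lam * lcoef lam m.
  apply: (@seq_choice _ _ (0 : rat) _ (fun lam C => C != 0 /\ forall m, m n = 0%N ->
    dcoeff (labpoly n lam) (mkmon n m (fun=> 0%N)) = C * lcoef lam m)) => lam lamL.
  by have [C C0 HC] := dcoeff_labpoly sh sum_nu lamL; exists C.
have -> : q = \sum_(lam <- labs_from K n nu i j | lam \in labs_from K n nu i j)
    (a lam / C lam) *: labpoly n lam.
  apply: Yfree_inj => // [|m mn].
    apply/YfreeP => M t Mt; rewrite dcoeff_sum big1 // => lam _.
    by move/YfreeP: (@Yfree_labpoly n lam) => Yl; rewrite dcoeffZ (Yl _ _ Mt) mulr0.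
  rewrite Ha // dcoeff_sum big_seq; apply: eq_bigr => lam lamL.
  have [CN0 HCl] := HC _ lamL.
  by rewrite dcoeffZ HCl // mulrA divfK.
by apply: span_comb => lam lamL; exists lam.
Qed.

Lemma labpoly_free (S : seq (QXY n)) (c : QXY n -> rat) : uniq S ->
  (forall p, p \in S -> exists2 lam, lam \in labs_from K n nu i j & p = labpoly n lam) ->
  \sum_(p <- S) c p *: p = 0 -> forall p, p \in S -> c p = 0.
Proof.
move=> uS HS sum0.
have [g Hg] : exists g : QXY n -> seq (nat * nat), forall p, p \in S ->
    g p \in labs_from K n nu i j /\ p = labpoly n (g p).
  apply: (@seq_choice _ _ [::] _ (fun p lam =>
    lam \in labs_from K n nu i j /\ p = labpoly n lam)) => p /HS[lam lamL pE].
  by exists lam.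
have [C HC] : exists C : QXY n -> rat, forall p, p \in S ->
    C p != 0 /\ forall m, m n = 0%N ->
      dcoeff p (mkmon n m (fun=> 0%N)) = C p * lcoef (g p) m.
  apply: (@seq_choice _ _ (0 : rat) _ (fun p C => C != 0 /\ forall m, m n = 0%N ->
    dcoeff p (mkmon n m (fun=> 0%N)) = C * lcoef (g p) m)) => p /Hg[gL pE].
  by have [C C0 HC] := dcoeff_labpoly sh sum_nu gL; exists C; rewrite {1}pE.
(* Distinct polynomials have distinct labels, so each of these sums has at most one term. *)
pose a lam := \sum_(p <- S | g p == lam) c p * C p.
have a0 : forall lam, lam \in labs_from K n nu i j -> a lam = 0.
  apply: (labs_from_free sh sum_nu) => m mn.
  under eq_bigr do rewrite /a mulr_suml big_mkcond.
  rewrite exchange_big big_seq /=.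
  rewrite (eq_bigr (fun p => c p * dcoeff p (mkmon n m (fun=> 0%N)))) => [|p pS]; last first.
    have [gL _] := Hg p pS; have [_ ->] := HC p pS; last by [].
    rewrite (bigD1_seq (g p)) ?uniq_labs_from //= eqxx big1 ?addr0 ?mulrA // => lam NE.
    by rewrite eq_sym (negbTE NE).
  rewrite -big_seq; under eq_bigr do rewrite -dcoeffZ.
  by rewrite -dcoeff_sum sum0 /dcoeff mcoeff0 mul0r.
move=> p pS; have [gL pE] := Hg p pS; have [CN0 _] := HC p pS.
apply: (mulIf CN0); rewrite mul0r -(a0 _ gL) /a big_seq_cond.
rewrite (big_rem p) //= pS eqxx big1_seq ?addr0 // => p' /andP[/andP[p'S /eqP gE] p'R].
move: p'R; rewrite mem_rem_uniq // inE => /andP[/eqP []].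
by have [_ ->] := Hg p' p'S; rewrite gE -pE.
Qed.

End Membership.

(** * From partitions, corners and tableaux to labels *)

Section Partitions.
Local Open Scope nat_scope.
Variable mu : seq nat.
Hypothesis mu_part : is_part mu.

Let K := size mu.
Let nu := nth 0 mu.

Lemma shape_part : shape K nu.
Proof.
have /andP[srt _] := mu_part.
split=> [r r' le_r|r]; last exact: nth_default.
have [r'K|Kr'] := ltnP r' K; last by rewrite /nu [nth 0 mu r']nth_default.
apply: (sorted_leq_nth _ _ _ srt) => //.
- by move=> ? ? ? /= h1 h2; apply: leq_trans h2 h1.
- by move=> ? /=.
by rewrite inE; apply: leq_ltn_trans r'K.
Qed.

Lemma sum_part : \sum_(r < K) nu r = sumn mu.
Proof. by rewrite sumnE (big_nth 0) big_mkord. Qed.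

Lemma corner_shape a b : is_corner mu (a, b) ->
  [/\ nu a.+1 < nu a, b = (nu a).-1 & a < K].
Proof.
case=> abD [nu' nu'_part E].
have abN : nth 0 nu' a <= b.
  by rewrite leqNgt -[_ < _](mem_diagram nu' (a, b)) E in_fsetD1 eqxx.
have lt_b : b < nu a by rewrite -[_ < _](mem_diagram mu (a, b)).
have /andP[srt _] := nu'_part.
have H p : p != (a, b) -> p \in diagram mu -> p.2 < nth 0 nu' p.1.
  by move=> pN pD; rewrite -mem_diagram E in_fsetD1 pN.
have le1 : nu a <= b.+1.
  rewrite leqNgt; apply/negP => lt.
  have /= := H (a, b.+1); rewrite mem_diagram xpair_eqE eqxx /= => /(_ _ lt); lia.
have le2 : nu a.+1 <= b.
  rewrite leqNgt; apply/negP => lt.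
  have /= := H (a.+1, b); rewrite mem_diagram xpair_eqE /= => /(_ _ lt).
  have lt_a : a.+1 < size nu' \/ size nu' <= a.+1 by case: ltnP; [left|right].
  case: lt_a => [lt_a|ge]; last by rewrite [nth 0 nu' a.+1]nth_default //; lia.
  have : nth 0 nu' a.+1 <= nth 0 nu' a.
    by have /(sortedP 0) := srt; apply.
  lia.
split; [lia|lia|].
by rewrite ltnNge; apply/negP => /(proj2 shape_part); rewrite -/nu; lia.
Qed.

Lemma shape_corner a : nu a.+1 < nu a -> is_corner mu (a, (nu a).-1).
Proof.
move=> lt_a; have sh := shape_part; have shd := shape_dec sh lt_a.
split; first by rewrite mem_diagram /= -/nu; lia.
(* Cutting at the height of column 0 keeps exactly the nonempty rows, as [is_part] requires. *)
have nthE r : nth 0 (mkseq (dec nu a) (colh K (dec nu a) 0)) r = dec nu a r.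
  have [lt|ge] := ltnP r (colh K (dec nu a) 0); first by rewrite nth_mkseq.
  rewrite nth_default ?size_mkseq //.
  by move: ge; rewrite leqNgt (ltn_colh _ _ shd) -leqNgt leqn0 => /eqP.
exists (mkseq (dec nu a) (colh K (dec nu a) 0)).
  apply/andP; split.
    apply/(sortedP 0) => r _; rewrite !nthE; exact: (proj1 shd).
  apply/(all_nthP 0) => r; rewrite size_mkseq => lt; rewrite nthE.
  by rewrite -(ltn_colh _ _ shd).
apply/fsetP => -[r c]; rewrite in_fsetD1 !mem_diagram nthE /= -/nu /dec xpair_eqE.
by have [->|rN] := eqVneq r a => /=; [rewrite -/nu|]; lia.
Qed.

Lemma mem_diagram_corner a p : nu a.+1 < nu a ->
  (p \in (diagram mu `\ (a, (nu a).-1))%fset) = (p.2 < dec nu a p.1).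
Proof.
move=> lt_a; rewrite in_fsetD1 mem_diagram -/nu /dec; case: p => r c /=.
by rewrite xpair_eqE; have [->|rN] := eqVneq r a => /=; lia.
Qed.

(** All entries of the next column are smaller than [n], so alpha is the number of rows of the same
    length as row [a], whatever [T] is. *)
Lemma std_corner_alpha n a T : sumn mu = n.+1 -> nu a.+1 < nu a ->
  is_standard n.+1 (diagram mu) T -> T (a, (nu a).-1) = n ->
  alpha (diagram mu) T n = a.+1 - colh K nu (nu a).
Proof.
move=> mu_size lt_a stdT Tn; have sh := shape_part.
have a_gt0 : 0 < nu a by lia.
have sum_nu : \sum_(r < K) nu r = n.+1 by rewrite sum_part.
have memD := mem_diagram mu; have [[_ Tinj] _ _] := stdT.
have cornerD : (a, (nu a).-1) \in diagram mu by rewrite memD /= -/nu; lia.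
rewrite (alpha_std sh sum_nu memD stdT (ltnSn n)).
have posE : position (diagram mu) T n = (a, (nu a).-1) by rewrite -Tn position_eq.
have [[uP memP _ _] _] := std_tab_cells sh sum_nu memD stdT.
rewrite posE /= prednK // -(count_col (nu a) sh uP memP) /tab_cells mkseqS_rcons.
rewrite -[in RHS]cats1 count_cat /= posE /= (_ : (_ == nu a) = false) ?addn0; last lia.
by rewrite -cats1 take_size_cat ?size_mkseq.
Qed.

Lemma corner_alpha_std n a P : sumn mu = n.+1 -> nu a.+1 < nu a ->
  size P = n -> std_cells (dec nu a) P ->
  corner_alpha n mu (a, (nu a).-1) (a.+1 - colh K nu (nu a)).
Proof.
move=> mu_size lt_a szP stdP; have sh := shape_part.
have stdP' := std_cells_rcons sh lt_a stdP.
have szP' : size (rcons P (a, (nu a).-1)) = n.+1 by rewrite size_rcons szP.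
have [stdT _] := std_cells_tab szP' stdP' (mem_diagram mu).
have TE : index (a, (nu a).-1) (rcons P (a, (nu a).-1)) = n.
  case: stdP' => uP' _ _ _; rewrite -cats1 index_cat /= eqxx addn0 szP.
  by move: uP'; rewrite rcons_uniq => /andP[/negbTE ->].
exists (index ^~ (rcons P (a, (nu a).-1))); split=> //.
exact: std_corner_alpha.
Qed.

Lemma shift_up_lift T u b p : shift_up u b T (lift_cell u b p) = T p.
Proof.
case: p => r c; rewrite /shift_up /lift_cell /=; have [->|cN] /= := eqVneq c b; last by rewrite addn0.
by case: (leqP u r) => /= h; rewrite ?addn0 ?h // addn1 ltnNge (leq_trans h).
Qed.

(** [lift_cell] is a bijection from [D] to [D'] that carries [T] to its shift. *)
Lemma shift_up_tableau n a u T : nu a.+1 < nu a -> u <= a ->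
  let D' := (diagram mu `\ (u, (nu a).-1))%fset in
  let D := (diagram mu `\ (a, (nu a).-1))%fset in
  is_tableau n D T -> sumn mu = n.+1 ->
  [/\ is_tableau n D' (shift_up u (nu a).-1 T), size (enum_fset D') = n &
      tab_cells n D' (shift_up u (nu a).-1 T) =
      map (lift_cell u (nu a).-1) (tab_cells n D T)].
Proof.
move=> lt_a ua D' D tabT mu_size; have sh := shape_part.
set b := (nu a).-1 in D' D tabT *.
have aK : a < K by rewrite ltnNge; apply/negP => /(proj2 sh) E; rewrite E in lt_a.
have a_gt0 : 0 < nu a by lia.
have sum_nu : \sum_(r < K) nu r = n.+1 by rewrite sum_part.
have memD p : (p \in D) = (p.2 < dec nu a p.1) by apply: mem_diagram_corner.
have szD : size (enum_fset D) = n.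
  by rewrite (size_fset_cells (shape_dec sh lt_a) memD) (sum_dec aK a_gt0 sum_nu).
have [_ permD] := perm_lift_cells sh lt_a (fset_uniq D) memD ua.
have liftD p : p \in D' -> exists2 q, q \in D & p = lift_cell u b q.
  rewrite in_fsetD1 => /andP[pN pmu].
  have : p \in rcons (map (lift_cell u b) (enum_fset D)) (u, b).
    rewrite (perm_mem permD) mem_rcons inE.
    by have [//|pNa] := eqVneq p (a, b); rewrite /= in_fsetD1 pNa.
  by rewrite mem_rcons inE (negbTE pN) => /mapP[q qD ->]; exists q.
have Dlift q : q \in D -> lift_cell u b q \in D'.
  rewrite memD => qD; rewrite in_fsetD1 lift_cell_neq mem_diagram andTb.
  exact: (lift_cell_mem u sh lt_a qD).
have [Tn Tinj] := tabT.
have tabT' : is_tableau n D' (shift_up u b T).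
  split=> [p /liftD[q qD ->]|p p' /liftD[q qD ->] /liftD[q' q'D ->]].
    by rewrite shift_up_lift Tn.
  by rewrite !shift_up_lift => /(Tinj _ _ qD q'D) ->.
split=> //.
  have : perm_eq (enum_fset D') (map (lift_cell u b) (enum_fset D)).
    apply: uniq_perm; first exact: fset_uniq.
      by rewrite (map_inj_uniq (@lift_cell_inj u b)) fset_uniq.
    by move=> p; apply/idP/mapP => [/liftD//|[q qD ->]]; apply: Dlift.
  by move/perm_size ->; rewrite size_map.
have onto := tableau_onto tabT szD; have [_ Tinj'] := tabT'.
rewrite /tab_cells /mkseq -map_comp; apply/eq_in_map => s.
rewrite mem_iota => /andP[_ lt_s] /=; have [pD TE] := onto _ lt_s.
by rewrite -{1}TE -(shift_up_lift T u b) position_eq // Dlift.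
Qed.

Variables n i j : nat.
Hypothesis mu_size : sumn mu = n.+1.

Let sh := shape_part.
Let sum_nu : \sum_(r < K) nu r = n.+1. Proof. by rewrite sum_part. Qed.

(** The bound [u <= i + al - 1] becomes the condition of [labs_from_intro], and the bounds on the
    exponents become [exp_bound]. *)
Lemma B_set_labpoly (q : QXY n) : B_set mu i j q ->
  exists2 lam, lam \in labs_from K n nu i j & q = labpoly n lam.
Proof.
case=> a [b [al [u [/corner_shape[lt_a -> aK] /andP[ia jb] [T0 [stdT0 T0n alE]] /andP[iu]]]]].
rewrite leq_min => /andP[ual ua] [T [m [stdT mlt m0 ->]]].
rewrite (std_corner_alpha mu_size lt_a stdT0 T0n) in alE.
have a_gt0 : 0 < nu a by lia.
have shd := shape_dec sh lt_a; have sumd := sum_dec aK a_gt0 sum_nu.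
have memD p := mem_diagram_corner p lt_a.
set D := (diagram mu `\ (a, (nu a).-1))%fset in stdT mlt memD *.
have [tabT _ _] := stdT.
have [tabT' szD' cellsE] := shift_up_tableau lt_a ua tabT mu_size.
have [stdP idx] := std_tab_cells shd sumd memD stdT.
set P := tab_cells n D T in stdP idx cellsE *.
have szP : size P = n by rewrite size_mkseq.
pose k := nth 0 m.
have expP : exp_bound P k.
  move=> s; rewrite szP => lt_s; have := mlt (Ordinal lt_s).
  rewrite (mnm_nth 0) /= -/k (alpha_std shd sumd memD stdT lt_s) -/P.
  by rewrite (nth_mkseq _ _ lt_s) ltn_subRL ltnS addnC.
have [lamL lamE] := std_cells_labs shd sumd stdP expP.
set lam := mkseq _ n in lamL lamE.
have szlam : size lam = n by rewrite size_mkseq.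
exists (rcons lam ((nu a).-1, u)).
  apply: labs_from_intro => //; first by rewrite iu.
    by lia.
  have : colh K nu (nu a) <= a by rewrite leqNgt ltn_colh // ltnn.
  by lia.
rewrite /labpoly /lexp /lcol nth_rcons szlam ltnn eqxx -cats1 take_size_cat // lamE /=.
rewrite (Garnir_gdet tabT' szD') cellsE; congr mderivm.
apply: mnm_splitP => s; rewrite ?mkmonl ?mkmonr //.
by rewrite nth_cat szlam ltn_ord nth_mkseq //= (mnm_nth 0).
Qed.

Lemma labpoly_B_set lam : lam \in labs_from K n nu i j ->
  B_set mu i j (labpoly n lam).
Proof.
case/labs_fromP=> r [lam1 [ir rK jr lam1L ->]].
have [le_r nua lt_a aK] := lrowP sh (leq_ltn_trans (leq0n j) jr).
set a := lrow K nu r in le_r nua lt_a aK lam1L *.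
have a_gt0 : 0 < nu a by lia.
have shd := shape_dec sh lt_a; have sumd := sum_dec aK a_gt0 sum_nu.
have [stdP expP] := labs_std_cells shd sumd lam1L.
have [szlam _ _ _] := labs_fills shd sumd lam1L.
rewrite -nua; set u := i + a - r.
have ua : u <= a by rewrite /u; lia.
have szP : size (lcells lam1) = n by rewrite size_lcells.
have memD p := mem_diagram_corner p lt_a.
have [stdT cellsT] := std_cells_tab szP stdP memD.
set D := (diagram mu `\ (a, (nu a).-1))%fset in stdT cellsT memD *.
set T := index ^~ _ in stdT cellsT.
have [tabT _ _] := stdT.
have [tabT' szD' cellsE] := shift_up_tableau lt_a ua tabT mu_size.
exists a, (nu a).-1, (a.+1 - colh K nu (nu a)), u; split.
- exact: shape_corner.
- by rewrite (leq_trans ir le_r); lia.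
- exact: corner_alpha_std stdP.
(* Row [r] has length [nu a], so it does not meet column [nu a]; this bounds [u - i = a - r] by
   alpha minus 1. *)
- have : ~~ (r < colh K nu (nu a)) by rewrite ltn_colh // nua ltnn.
  by rewrite leq_min /u; lia.
exists T, (mkmon n (lexp lam1) (fun=> 0)); split=> // [s|s|].
- rewrite mkmonl (alpha_std shd sumd memD stdT (ltn_ord s)) cellsT.
  have := expP s; rewrite szP ltn_ord => /(_ isT).
  by rewrite -[in nth _ _ _]cellsT (nth_mkseq _ _ (ltn_ord s)); lia.
- by rewrite mkmonr.
rewrite (Garnir_gdet tabT' szD') cellsE cellsT.
rewrite /labpoly /lexp /lcol nth_rcons szlam ltnn eqxx -cats1 take_size_cat //=.
congr mderivm; apply: mnm_splitP => s; rewrite ?mkmonl ?mkmonr //.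
by rewrite nth_cat szlam ltn_ord.
Qed.

End Partitions.

Theorem theorem3p1 (n : nat) (mu : seq nat) (i j : nat)
    (mu_part : is_part mu) (mu_size : sumn mu = n.+1)
    (ij_mu : (i, j) \in diagram mu) :
  is_basis (@B_set n mu i j) (@space_M0 n (diagram mu `\ (i, j))%fset).
Proof.
have sh := shape_part mu_part.
have sum_nu := etrans (sum_part mu) mu_size.
have memD := mem_diagram mu.
split=> [s a us Hs|q].
  apply: (labpoly_free sh sum_nu us) => p /Hs.
  exact: B_set_labpoly.
split=> [/(space_M_span sh sum_nu memD ij_mu) [s Hs ->]|[s Hs ->]].
  exists s => // x /Hs[lam lamL ->]; exact: labpoly_B_set.
have Hlab x : x \in s -> exists2 lam, lam \in labs_from (size mu) n (nth 0 mu) i j &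
    x.2 = labpoly n lam by move/Hs/(B_set_labpoly mu_part mu_size).
split.
  apply: span_sum => x /Hlab[lam lamL ->]; apply: span_scale.
  exact: (labpoly_in_space_M sh sum_nu memD ij_mu lamL).
apply/YfreeP => M t Mt; rewrite dcoeff_sum big_seq big1 // => x /Hlab[lam lamL ->].
by move/YfreeP: (@Yfree_labpoly n lam) => Yl; rewrite dcoeffZ (Yl _ _ Mt) mulr0.
Qed.
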